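(* For every integer $N\ge1$, the measure $\mu_N$ on $E_N$ is invariant under the flow $\Phi_N(t)$ of the truncated Benjamin-Ono equation $$(\partial_t+H\partial_x^2)u_N+S_N\big(\partial_x(u_N^2)\big)=0,\qquad u_N|_{t=0}=u_0\in E_N,$$ i.e. $\mu_N(\Phi_N(t)(A))=\mu_N(A)$ for every Borel set $A\subset E_N$ and every $t\in\mathbb{R}$.
   Context: Let $S^1=\mathbb{R}/(2\pi\mathbb{Z})$ and $\hat u(n)=(2\pi)^{-1}\int_{S^1}u(x)e^{-inx}dx$. For $N\ge1$, $E_N$ is the $2N$-dimensional real vector space of real valued trigonometric polynomials $u=\sum_{n=1}^N(a_n\cos(nx)+b_n\sin(nx))$, $a_n,b_n\in\mathbb{R}$, identified with $\mathbb{R}^{2N}$ through the coordinates $(a_1,\dots,a_N,b_1,\dots,b_N)$. $S_N u=\sum_{|n|\le N}\hat u(n)e^{inx}$. The Hilbert transform $H$ is defined by $\widehat{Hw}(n)=-i\,\mathrm{sign}(n)\hat w(n)$ for $n\ne0$ and $\widehat{Hw}(0)=0$. The truncated equation is an ODE on $E_N$ which has, for every $u_0\in E_N$, a unique solution global in time; $\Phi_N(t):E_N\to E_N$, $t\in\mathbb{R}$, denotes its flow. Let $\theta_N$ be the probability measure on $E_N$ given in the coordinates above by $$d\theta_N=N!\,e^{-\pi\sum_{n=1}^Nn(a_n^2+b_n^2)}\prod_{n=1}^Nda_n\,db_n.$$ Let $R>0$, let $\chi_R:\mathbb{R}\to[0,1]$ be a fixed continuous function with compact support such that $\chi_R(x)=1$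 for $|x|\le R$, and let $\alpha_N=\sum_{n=1}^N\frac1n$. Then $$d\mu_N(u_N)=\chi_R\big(\|u_N\|_{L^2(S^1)}^2-\alpha_N\big)e^{-\frac23\int_{S^1}u_N(x)^3dx}\,d\theta_N(u_N).$$ *)

(* Defs.v *)
From HB Require Import structures.
From mathcomp Require Import all_boot all_order all_algebra.
From mathcomp Require Import complex.
From mathcomp Require Import all_classical all_reals all_analysis.
From mathcomp Require Import measurable_realfun.

Set Implicit Arguments.
Unset Strict Implicit.
Unset Printing Implicit Defensive.

Import Order.TTheory GRing.Theory Num.Theory.
Import numFieldNormedType.Exports.

Local Open Scope classical_set_scope.
Local Open Scope ring_scope.

(* R^n with its Borel sigma-algebra. *)
Notation borel R n := (g_sigma_algebraType (@open 'rV[R]_n)).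

Section lebesgue_measure_rV.
Context {R : realType}.

Lemma continuous_measurable_rV n (f : 'rV[R]_n -> R) : continuous f ->
  measurable_fun [set: borel R n] (f : borel R n -> R).
Proof.
move=> /continuousP cf; apply: (measurability _ (RGenOpens.measurableE R)).
move=> _ [_ [a [b ->] <-]]; rewrite setTI; apply: sub_sigma_algebra.
exact/cf/interval_open.
Qed.

Lemma measurable_coord n (j : 'I_n) :
  measurable_fun [set: borel R n] (fun v : borel R n => (v : 'rV[R]_n) ord0 j).
Proof. by apply: continuous_measurable_rV; exact: coord_continuous. Qed.

Lemma open_bigcup_ball n (U : set 'rV[R]_n) : open U ->
  U = \bigcup_(p : 'rV[rat]_n * nat)
        (if `[< ball (map_mx ratr p.1 : 'rV[R]_n) p.2.+1%:R^-1 `<=` U >]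
         then ball (map_mx ratr p.1 : 'rV[R]_n) p.2.+1%:R^-1 else set0).
Proof.
rewrite openE => oU; apply/seteqP; split => [v Uv|v [p _]]; last first.
  by case: ifPn => // /asboolP; exact.
have /nbhs_ballP[e /= e0 eU] := oU _ Uv.
have e20 : 0 < e / 2 by rewrite divr_gt0.
have [k _ /(_ k (leqnn k)) /= ke] := near_infty_natSinv_lt (PosNum e20).
have k0 : 0 < k.+1%:R^-1 :> R by rewrite invr_gt0.
have Q i : {q : rat | (v ord0 i : R) - k.+1%:R^-1 < ratr q < (v ord0 i : R)}.
  apply: cid; have [|q /itvP qi] := @rat_in_itvoo R (v ord0 i - k.+1%:R^-1) (v ord0 i).
    by rewrite gtrBl.
  by exists q; rewrite !qi.
pose q : 'rV[rat]_n := \row_i sval (Q i).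
have qv i : `|ratr (q ord0 i) - v ord0 i| < k.+1%:R^-1.
  rewrite mxE; case: (Q i) => r /= /andP[r1 r2].
  by rewrite ltr_norml; apply/andP; split; [rewrite ltrBrDr addrC|
    rewrite (lt_trans _ k0)// subr_lt0].
have qvb : ball (map_mx ratr q : 'rV[R]_n) k.+1%:R^-1 v.
  by split=> // i j; rewrite (ord1 i) mxE; exact: qv.
exists (q, k) => //; case: ifPn => //= /negP[]; apply/asboolP.
apply: (subset_trans _ eU) => w qw.
have kke : k.+1%:R^-1 + k.+1%:R^-1 <= e :> R by rewrite [leRHS]splitr lerD// ltW.
by apply: (le_ball kke); apply: ball_triangle qw; exact: ball_sym.
Qed.

Lemma measurable_fun_rV d (T : measurableType d) n (f : T -> borel R n) :
  (forall j, measurable_fun [set: T] (fun x => (f x : 'rV[R]_n) ord0 j)) ->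
  measurable_fun [set: T] f.
Proof.
move=> mf; apply: (@measurability _ _ _ (borel R n) _ _ (@open 'rV[R]_n) erefl) => _ [U oU <-].
rewrite setTI (open_bigcup_ball oU) preimage_bigcup.
apply: countable_bigcupT_measurable => // p.
case: ifPn => _; last by rewrite preimage_set0.
have -> : f @^-1` ball (map_mx ratr p.1 : 'rV[R]_n) p.2.+1%:R^-1 =
    \bigcap_(j in [set: 'I_n]) ((fun x => (f x : 'rV[R]_n) ord0 j) @^-1`
       ball (ratr (p.1 ord0 j) : R) p.2.+1%:R^-1).
  apply/seteqP; split => x /=.
    by move=> [_ h] j _; have := h ord0 j; rewrite mxE.
  by move=> h; split=> // i j; rewrite (ord1 i) mxE; exact: h.
apply: fin_bigcap_measurable => // j _.
rewrite -[X in measurable X]setTI; apply: mf => //.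
by apply: open_measurable; exact: ball_open.
Qed.

Definition cons_rV n (p : R * borel R n) : borel R n.+1 :=
  row_mx (p.1%:M : 'rV[R]_1) (p.2 : 'rV[R]_n).

Definition uncons_rV n (v : borel R n.+1) : R * borel R n :=
  ((v : 'rV[R]_n.+1) ord0 ord0,
   \row_j (v : 'rV[R]_n.+1) ord0 (lift ord0 j) : 'rV[R]_n).

Lemma cons_rVK n : cancel (@cons_rV n) (@uncons_rV n).
Proof.
move=> [x v]; rewrite /cons_rV /uncons_rV /=; congr pair.
  rewrite -[RHS](_ : (x%:M : 'M[R]_1) ord0 ord0 = _); last by rewrite mxE eqxx.
  by rewrite -[RHS](row_mxEl _ v); apply: congr1; exact/val_inj.
apply/rowP => j; rewrite mxE -[RHS](row_mxEr (x%:M : 'M[R]_1)).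
by apply: congr1; exact/val_inj.
Qed.

Lemma measurable_cons_rV n : measurable_fun [set: R * borel R n] (@cons_rV n).
Proof.
apply: measurable_fun_rV => j.
rewrite -(splitK (j : 'I_(1 + n))); case: (fintype.split _) => i /=.
- rewrite [X in measurable_fun _ X](_ : _ = fst) //.
  by apply/funext => p; rewrite /cons_rV (row_mxEl (p.1%:M : 'M[R]_1) (p.2 : 'rV[R]_n) ord0 i) (ord1 i) mxE eqxx.
- rewrite [X in measurable_fun _ X]
    (_ : _ = (fun v : borel R n => (v : 'rV[R]_n) ord0 i) \o snd).
    by apply: measurableT_comp => //; exact: measurable_coord.
  by apply/funext => p; rewrite /cons_rV (row_mxEr (p.1%:M : 'M[R]_1) (p.2 : 'rV[R]_n) ord0 i).
Qed.

Lemma measurable_uncons_rV n : measurable_fun [set: borel R n.+1] (@uncons_rV n).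
Proof.
apply/measurable_fun_pairP; split; first exact: measurable_coord.
apply: measurable_fun_rV => j.
rewrite [X in measurable_fun _ X](_ : _ =
  fun v : borel R n.+1 => (v : 'rV[R]_n.+1) ord0 (lift ord0 j)).
  exact: measurable_coord.
by apply/funext => v; rewrite /= mxE.
Qed.

End lebesgue_measure_rV.

Section lebesgue_cons.
Context {R : realType} (n : nat).
Variable mu : {sigma_finite_measure set (borel R n) -> \bar R}.

Definition lebesgue_cons : set (borel R n.+1) -> \bar R :=
  pushforward (@lebesgue_measure R \x mu)%E (@cons_rV R n).

Let mcons := @measurable_cons_rV R n.

Let lebesgue_cons0 : lebesgue_cons set0 = 0%E.
Proof. exact: measure0. Qed.

Let lebesgue_cons_ge0 A : (0 <= lebesgue_cons A)%E.
Proof. exact: measure_ge0. Qed.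

Let lebesgue_cons_sigma_additive : semi_sigma_additive lebesgue_cons.
Proof. exact: measure_semi_sigma_additive. Qed.

HB.instance Definition _ := isMeasure.Build _ _ _ lebesgue_cons
  lebesgue_cons0 lebesgue_cons_ge0 lebesgue_cons_sigma_additive.

Let lebesgue_cons_sigma_finite : sigma_finite setT lebesgue_cons.
Proof.
have /sigma_finiteP[F [TF ndF Foo]] := sigma_finiteT (@lebesgue_measure R).
have /sigma_finiteP[G [TG ndG Goo]] := sigma_finiteT mu.
exists (fun k => (@uncons_rV R n) @^-1` (F k `*` G k)).
  rewrite -preimage_bigcup (_ : \bigcup_k _ = setT) ?preimage_setT//.
  rewrite -subTset => -[x v] _.
  have [k _ Fkx] : (\bigcup_k F k) x by rewrite -TF.
  have [l _ Glv] : (\bigcup_k G k) v by rewrite -TG.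
  exists (maxn k l) => //; split => /=.
  - by move: x Fkx; exact/subsetPset/ndF/leq_maxl.
  - by move: v Glv; exact/subsetPset/ndG/leq_maxr.
move=> k; have [mF Fk] := Foo k; have [mG Gk] := Goo k; split.
  rewrite -[X in measurable X]setTI; apply: measurable_uncons_rV => //.
  exact: measurableX.
rewrite /lebesgue_cons /pushforward -comp_preimage.
rewrite (_ : _ \o _ = id); last by apply/funext => x; exact: cons_rVK.
by rewrite preimage_id product_measure1E// lte_mul_pinfty// ge0_fin_numE.
Qed.

HB.instance Definition _ :=
  Measure_isSigmaFinite.Build _ _ _ lebesgue_cons lebesgue_cons_sigma_finite.

End lebesgue_cons.

(* Lebesgue measure on R^n, built by induction as the image of dx \x dv under
   (x, v) |-> row_mx x v; the library has no n-fold Lebesgue measure. *)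
Fixpoint lebesgue_rV (R : realType) (n : nat) :
    {sigma_finite_measure set (borel R n) -> \bar R} :=
  match n return {sigma_finite_measure set (borel R n) -> \bar R} with
  | 0%N => \d_((0 : 'rV[R]_0) : borel R 0)
  | m.+1 => lebesgue_cons (lebesgue_rV R m)
  end.

Section fourier.
Context {R : realType}.
Implicit Types (u w : R -> R) (n : int) (M N : nat).

(* Functions on S^1 = R / 2 pi Z are 2 pi-periodic functions on R, and the
   integral over S^1 is the integral over a period. *)
Definition circle_int u : R :=
  \int[lebesgue_measure]_(x in `[0, 2 * pi]) u x.

Definition circle_cint (f : R -> R[i]) : R[i] :=
  (circle_int (fun x => complex.Re (f x)) +i*
   circle_int (fun x => complex.Im (f x)))%C.

Definition expi (x : R) : R[i] := (cos x +i* sin x)%C.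

Definition fourier u n : R[i] :=
  ((2 * pi)^-1)%:C%C * circle_cint (fun x => (u x)%:C%C * expi (- (n%:~R * x))).

(* \sum_(|n| <= M) m n * fourier w n * e^(inx). The real part only changes the
   codomain: for real valued w and m (- n) = (m n)^*, as in both uses below,
   the sum is real. *)
Definition fourier_sum (m : int -> R[i]) M w (x : R) : R :=
  complex.Re (\sum_(k < (2 * M).+1)
    let n := k%:Z - M%:Z in m n * fourier w n * expi (n%:~R * x)).

Definition S_ N w : R -> R := fourier_sum (fun=> 1) N w.

(* The Fourier series of H w, summed pointwise by symmetric partial sums. *)
Definition hilbert w (x : R) : R :=
  lim (fourier_sum (fun n => - 'i%C * (sgz n)%:~R) M w x @[M --> \oo]).

Definition L2norm u : R := Num.sqrt (circle_int (fun x => u x ^+ 2)).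

End fourier.

(* E_N in the coordinates (a_1, ..., a_N, b_1, ..., b_N). *)
Notation E_ R N := 'rV[R]_(N + N).

Section truncated_benjamin_ono.
Context {R : realType} (N : nat).
Implicit Types c : E_ R N.

(* a_n and b_n for n = k.+1 *)
Definition acoef c (k : 'I_N) : R := c ord0 (lshift N k).
Definition bcoef c (k : 'I_N) : R := c ord0 (rshift N k).

Definition trigpoly c (x : R) : R :=
  \sum_(k < N) (acoef c k * cos (k.+1%:R * x) + bcoef c k * sin (k.+1%:R * x)).

Definition is_bo_solution (u : R -> E_ R N) :=
  forall t : R, derivable u t 1 /\
    forall x : R,
      trigpoly (derive1 u t) x + hilbert (derive1n 2 (trigpoly (u t))) x
        + S_ N (derive1 (fun y => trigpoly (u t) y ^+ 2)) x = 0.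

(* Solutions are global and unique, so this determines Phi. *)
Definition is_bo_flow (Phi : R -> E_ R N -> E_ R N) :=
  forall u0 : E_ R N, Phi 0 u0 = u0 /\ is_bo_solution (fun t => Phi t u0).

Definition gauss_density c : R :=
  N`!%:R *
  expR (- (pi * \sum_(k < N) k.+1%:R * (acoef c k ^+ 2 + bcoef c k ^+ 2))).

Definition theta : set (borel R (N + N)) -> \bar R :=
  fun A => (\int[lebesgue_rV R (N + N)]_(c in A) (gauss_density c)%:E)%E.

Lemma gauss_density_ge0 c : 0 <= gauss_density c.
Proof. by rewrite mulr_ge0// expR_ge0. Qed.

Lemma measurable_gauss_density :
  measurable_fun [set: borel R (N + N)] (gauss_density : borel R (N + N) -> R).
Proof.
apply: measurable_funM => //; apply: measurableT_comp => //.
apply: measurableT_comp => //; apply: measurable_funM => //.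
apply: measurable_sum => k; apply: measurable_funM => //.
by apply: measurable_funD; apply: measurable_funX; exact: measurable_coord.
Qed.

Let theta0 : theta set0 = 0%E.
Proof. by rewrite /theta integral_set0. Qed.

Let theta_ge0 A : (0 <= theta A)%E.
Proof. by apply: integral_ge0 => c _; rewrite lee_fin gauss_density_ge0. Qed.

Let theta_sigma_additive : semi_sigma_additive theta.
Proof.
move=> F mF tF mUF; rewrite /theta ge0_integral_bigcup//=.
- by apply: is_cvg_ereal_nneg_natsum_cond => n _ _; exact: theta_ge0.
- apply/measurable_EFinP; apply: measurable_funTS.
  exact: measurable_gauss_density.
- by move=> c _; rewrite lee_fin gauss_density_ge0.
Qed.

HB.instance Definition _ := isMeasure.Build _ _ _ theta
  theta0 theta_ge0 theta_sigma_additive.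

Definition alpha : R := \sum_(1 <= n < N.+1) n%:R^-1.

Definition gibbs (chi : R -> R) : set (borel R (N + N)) -> \bar R :=
  fun A => (\int[theta]_(c in A)
    (chi (L2norm (trigpoly c) ^+ 2 - alpha) *
     expR (- (2 / 3) * circle_int (fun x => trigpoly c x ^+ 3)))%:E)%E.

End truncated_benjamin_ono.

(* Main.v *)
Require Import Defs.
From HB Require Import structures.
From mathcomp Require Import all_boot all_order all_algebra.
From mathcomp Require Import complex.
From mathcomp Require Import all_classical all_reals all_analysis.
From mathcomp Require Import measurable_realfun.
From mathcomp Require Import ring lra zify.

Set Implicit Arguments.
Unset Strict Implicit.

Import Order.TTheory GRing.Theory Num.Theory.
Import numFieldNormedType.Exports.

Local Open Scope classical_set_scope.
Local Open Scope ring_scope.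

(** In the coordinates of [E_ R N] the truncated equation is an autonomous ODE
    [c' = bo_field c], and the Gibbs measure has a density [gibbs_weight] with
    respect to Lebesgue measure. The theorem is the sum of two facts: the
    density is constant along orbits, and the flow preserves Lebesgue measure.

    The density depends on [c] only through the square of the L^2 norm and
    through [hamiltonian]. Both are conserved because [bo_field] is a skew
    gradient: with P_n and Q_n the integrals of u^2 against cos(nx) and sin(nx),
    one has a_n' = - (n / pi) (pi n b_n + Q_n) and
    b_n' = (n / pi) (pi n a_n + P_n), and the gradient of the Hamiltonian is
    twice (pi n a_n + P_n, pi n b_n + Q_n); the L^2 norm is conserved because
    u^2 u_x integrates to zero.

    Preservation of volume (Liouville) is obtained without differentiating the
    flow with respect to the initial datum. The field is a finite sum of shears
    c |-> g (<c, w>) v with <v, w> = 0: the integrals P_n and Q_n are computed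
    exactly by the equispaced quadrature rule with 3 N + 1 nodes
    ([exact_quad_sq]), each node contributes the shear with profile u(x_j)^2,
    and the linear part is a sum of coordinate shears ([bo_field_shears]). The map
    c |-> c + g (<c, w>) v is a limit of maps that translate each slab of a
    partition into itself, so it does not increase the measure of open sets
    ([vol_nonincr_shear]). The flow is the limit of compositions of such maps
    (Lie splitting, [split_step_cvg]), and Fatou's lemma passes the inequality
    to the limit ([vol_flow_le]). Applied to the flow and to its inverse, the
    inequality becomes an equality on open sets, hence on Borel sets
    ([shear_flow_volume]). *)

(** * Lebesgue measure on R^n: translations, limits of maps, shears *)
Section lebesgue_rV_theory.
Context {R : realType}.

Lemma lebesgue_measure_translate (a : R) (A : set R) : measurable A ->
  lebesgue_measure ((fun x => x + a) @^-1` A) = lebesgue_measure A.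
Proof.
move=> mA.
have mT : measurable_fun [set: measurableTypeR R]
    ((fun x => x + a) : measurableTypeR R -> measurableTypeR R).
  by apply: measurable_funD => //; exact: measurable_cst.
pose m : {mfun _ >-> _} := HB.pack ((fun x => x + a) : measurableTypeR R -> measurableTypeR R)
  (isMeasurableFun.Build _ _ _ _ _ mT).
apply/esym/(@lebesgue_measure_unique _ (pushforward lebesgue_measure m)) => //=.
move=> _ [[x y]] _ <-; rewrite /pushforward/=.
rewrite [X in _ = lebesgue_measure X](_ : _ = `]x - a, y - a]%classic).
  rewrite lebesgue_measure_itv/= lebesgue_measure_itv/= !lte_fin ltrD2r.
  by case: ifPn => // _; rewrite -!EFinB; congr EFin; ring.
by apply/seteqP; split => z /=; rewrite !in_itv/= ltrBlDr lerBrDr.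
Qed.

Lemma measurable_translate n (v : 'rV[R]_n) :
  measurable_fun [set: borel R n] ((fun c => c + v) : borel R n -> borel R n).
Proof.
apply: measurable_fun_rV => j.
rewrite (_ : (fun x => _) = (fun x : borel R n => (x : 'rV[R]_n) ord0 j + v ord0 j)).
  by apply: measurable_funD => //; exact: measurable_coord.
by apply/funext => x; rewrite !mxE.
Qed.

(** By induction on the dimension: a translation of R x R^n moves the section
    above [x] to the section above [x + a] and translates it, so the iterated
    integral is unchanged. *)
Lemma lebesgue_rV_translate n (v : 'rV[R]_n) (A : set (borel R n)) :
  measurable A ->
  lebesgue_rV R n ((fun c : 'rV[R]_n => c + v) @^-1` A) = lebesgue_rV R n A.
Proof.
elim: n v A => [|n IH] v A mA.
  by congr (lebesgue_rV R 0 _); apply/funext => c /=; rewrite (thinmx0 v) addr0.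
pose mu := lebesgue_rV R n.
pose C := @cons_rV R n @^-1` A.
have mC : measurable C.
  by rewrite -[C]setTI; exact: measurable_cons_rV.
pose a := v ord0 ord0; pose w : 'rV[R]_n := \row_j v ord0 (lift ord0 j).
have vE : v = @cons_rV R n (a, w).
  apply/rowP => j; rewrite /cons_rV/=.
  case: (unliftP ord0 j) => [i|] ->.
    rewrite -[RHS](_ : row_mx (a%:M : 'rV[R]_1) w ord0 (rshift 1 i) = _).
      by rewrite row_mxEr mxE.
    by apply: congr1; exact/val_inj.
  rewrite -[RHS](_ : row_mx (a%:M : 'rV[R]_1) w ord0 (lshift n ord0) = _).
    by rewrite row_mxEl mxE eqxx.
  by apply: congr1; exact/val_inj.
have consD x y : @cons_rV R n (x, y) + v = @cons_rV R n (x + a, (y : 'rV_n) + w).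
  rewrite vE /cons_rV/= raddfD; exact: (add_row_mx (x%:M : 'rV[R]_1)).
transitivity (\int[@lebesgue_measure R]_x mu (xsection C ((x : R) + a)%R))%E.
  rewrite /= /lebesgue_cons /pushforward /= /product_measure1.
  apply: eq_integral => x _ /=.
  rewrite -[RHS](IH w); last exact: measurable_xsection.
  congr (mu _); apply/seteqP; split => y /=.
    by rewrite /xsection/= !inE /= consD.
  by rewrite /xsection/= !inE /= consD.
transitivity (\int[@lebesgue_measure R]_x mu (xsection C x))%E; last by [].
have mT : measurable_fun [set: measurableTypeR R]
    ((fun x => x + a) : measurableTypeR R -> measurableTypeR R).
  by apply: measurable_funD => //; exact: measurable_cst.
have := @ge0_integral_pushforward _ _ _ _ R _ mT lebesgue_measure setT
  (fun x => mu (xsection C x)) measurableT.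
rewrite preimage_setT => <-.
- by apply: eq_measure_integral => B mB _; exact: lebesgue_measure_translate.
- exact: measurable_fun_xsection.
- by move=> x _.
Qed.

(** Gives the exhaustion by open sets of finite measure along which measures
    that agree on open sets are identified. *)
Lemma lebesgue_rV_ball_lty n (r : R) :
  (lebesgue_rV R n (ball (0%R : 'rV[R]_n) r) < +oo)%E.
Proof.
elim: n => [|n IH]; first by rewrite /= diracE ltry.
have mb : measurable (ball (0 : 'rV[R]_n) r : set (borel R n)).
  by apply: sub_sigma_algebra; exact: ball_open.
have mbs : measurable (ball (0 : 'rV[R]_n.+1) r : set (borel R n.+1)).
  by apply: sub_sigma_algebra; exact: ball_open.
rewrite /= /lebesgue_cons /pushforward.
apply: (@le_lt_trans _ _ ((lebesgue_measure \x lebesgue_rV R n)%E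
    ((ball (0%R:R) r) `*` (ball (0%R : 'rV[R]_n) r : set (borel R n))))).
  apply: le_measure; rewrite ?inE.
  - rewrite -[X in measurable X]setTI; exact: measurable_cons_rV.
  - by apply: measurableX => //; exact: measurable_ball.
  - move=> [x y] /= [r0 h].
    have [consl /rowP consr] := cons_rVK (x, y).
    have {}consr j : (cons_rV (x, y) : 'rV[R]_n.+1) ord0 (lift ord0 j) = (y : 'rV_n) ord0 j.
      by have := consr j; rewrite mxE.
    split => /=.
      by have := h ord0 ord0; rewrite consl mxE.
    by split => // i j; have := h ord0 (lift ord0 j); rewrite consr (ord1 i) !mxE.
rewrite product_measure1E//; last exact: measurable_ball.
have [r0|r0] := ltP 0 r; last first.
  have -> : ball (0:R) r = set0 by apply/ball0.
  by rewrite measure0 mul0e.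
rewrite lte_mul_pinfty// ge0_fin_numE//.
apply: (@le_lt_trans _ _ (r *+ 2)%:E); last exact: ltry.
by rewrite -(lebesgue_measure_ball 0 (ltW r0)).
Qed.

(** Volume preservation is weakened to an inequality on open sets because this
    form passes to pointwise limits; for an invertible map it is recovered by
    applying the inequality to the map and to its inverse. *)
Definition vol_nonincr {n} (S : 'rV[R]_n -> 'rV[R]_n) :=
  forall U : set 'rV[R]_n, open U ->
    (lebesgue_rV R n (S @^-1` U) <= lebesgue_rV R n U)%E.

(** Fatou's lemma: if [S c] lies in the open set [U] then so does [S_ k c] for
    large [k], hence the indicator of the preimage of [U] under [S] is at most
    the lower limit of the indicators of its preimages under [S_ k]. The set [B]
    allows convergence to be known only for bounded initial data. *)
Lemma vol_nonincr_limit n (B : set (borel R n)) (S_ : nat -> 'rV[R]_n -> 'rV[R]_n)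
    (S : 'rV[R]_n -> 'rV[R]_n) (U : set 'rV[R]_n) :
  measurable B -> open U ->
  (forall k, measurable (S_ k @^-1` U : set (borel R n))) ->
  (forall k, (lebesgue_rV R n (S_ k @^-1` U) <= lebesgue_rV R n U)%E) ->
  (forall c, B c -> S_ k c @[k --> \oo] --> S c) ->
  measurable (S @^-1` U : set (borel R n)) ->
  (lebesgue_rV R n (B `&` S @^-1` U) <= lebesgue_rV R n U)%E.
Proof.
move=> mB oU mSkU SU cS mSU.
pose f k (c : borel R n) : \bar R := (\1_(S_ k @^-1` U) c)%:E.
have mf k : measurable_fun B (f k).
  by apply/measurable_EFinP; exact: measurable_funTS.
have f0 k c : B c -> (0 <= f k c)%E by move=> _; rewrite lee_fin.
have := @fatou _ _ _ (lebesgue_rV R n) B mB f mf f0.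
move=> /le_trans h; have {}h := h (lebesgue_rV R n U).
apply: (@le_trans _ _ (\int[lebesgue_rV R n]_(c in B) limn_einf (f^~ c))%E).
  rewrite setIC -integral_indic//; apply: ge0_le_integral => //.
  - by apply/measurable_EFinP; exact: measurable_funTS.
  - apply: measurableT_comp => //; apply: measurable_fun_limn_esup => k.
    exact: measurableT_comp.
  - move=> c Bc; rewrite indicE; case: (boolP (_ \in _)) => [|_]; last first.
      rewrite limn_einf_lim; apply: lime_ge; first exact: is_cvg_einfs.
      by apply: nearW => k; apply: le_ereal_inf_tmp => _ [m _ <-]; exact: f0.
    rewrite inE /= => USc.
    suff /cvg_limn_einf_sup[-> _] : f^~ c @ \oo --> 1%E by [].
    apply: cvg_near_cst.
    have : \forall k \near \oo, U (S_ k c).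
      by apply: (cS c Bc); exact: open_nbhs_nbhs.
    by apply: filterS => k Uk; rewrite /f indicE mem_set.
apply: h.
rewrite limn_einf_lim; apply: lime_le; first exact: is_cvg_einfs.
apply: nearW => k; apply: (@le_trans _ _ (\int[lebesgue_rV R n]_(c in B) f k c)%E).
  by apply: ereal_inf_lbound; exists k => /=.
rewrite integral_indic//; apply: le_trans (SU k).
by apply: le_measure; rewrite ?inE//; exact: measurableI.
Qed.

Lemma vol_nonincr_comp n (S T : 'rV[R]_n -> 'rV[R]_n) :
  continuous T -> vol_nonincr S -> vol_nonincr T -> vol_nonincr (T \o S).
Proof.
move=> /continuousP cT hS hT U oU.
rewrite comp_preimage; apply: (le_trans (hS _ _)); first exact: cT.
exact: hT.
Qed.

Lemma continuous_measurable_rV_rV n (S : 'rV[R]_n -> 'rV[R]_n) : continuous S ->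
  measurable_fun [set: borel R n] (S : borel R n -> borel R n).
Proof.
move=> /continuousP cS.
apply: (@measurability _ _ _ (borel R n) _ _ (@open 'rV[R]_n) erefl) => _ [U oU <-].
by rewrite setTI; apply: sub_sigma_algebra; exact: cS.
Qed.

Definition dotrV {n} (c w : 'rV[R]_n) : R := \sum_i c ord0 i * w ord0 i.

Lemma dotrVDl n (c d w : 'rV[R]_n) : dotrV (c + d) w = dotrV c w + dotrV d w.
Proof.
by rewrite /dotrV -big_split/=; apply: eq_bigr => i _; rewrite mxE mulrDl.
Qed.

Lemma dotrVZl n (a : R) (c w : 'rV[R]_n) : dotrV (a *: c) w = a * dotrV c w.
Proof.
by rewrite /dotrV mulr_sumr; apply: eq_bigr => i _; rewrite mxE mulrA.
Qed.

Lemma dotrVBl n (c d w : 'rV[R]_n) : dotrV (c - d) w = dotrV c w - dotrV d w.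
Proof. by rewrite dotrVDl -scaleN1r dotrVZl mulN1r. Qed.

Definition norm1 {n} (w : 'rV[R]_n) : R := \sum_i `|w ord0 i|.

Lemma norm1_ge0 n (w : 'rV[R]_n) : 0 <= norm1 w.
Proof. by apply: sumr_ge0. Qed.

Lemma ler_coord n (c : 'rV[R]_n) i : `|c ord0 i| <= `|c|.
Proof.
rewrite [leRHS]/Num.Def.normr/= mx_normrE.
exact: (le_bigmax _ (fun ij => `|c ij.1 ij.2|) (ord0, i)).
Qed.

Lemma ler_norm_rV n (c : 'rV[R]_n) (M : R) : 0 <= M ->
  (forall i, `|c ord0 i| <= M) -> `|c| <= M.
Proof.
move=> M0 h; rewrite [leLHS]/Num.Def.normr/= mx_normrE.
by apply: bigmax_le => // -[i j] _ /=; rewrite (ord1 i).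
Qed.

Lemma ler_dotrV n (c w : 'rV[R]_n) : `|dotrV c w| <= norm1 w * `|c|.
Proof.
rewrite /norm1 mulr_suml; apply: le_trans (ler_norm_sum _ _ _) _.
by apply: ler_sum => i _; rewrite normrM mulrC ler_wpM2l// ler_coord.
Qed.

(** The estimate is asked for [`|y| <= `|x| + 1] only: this is how the stability
    estimate for flows is available, with a constant that depends on a bound for
    the initial data. *)
Lemma locally_lipschitz_continuous (V W : normedModType R) (f : V -> W) :
  (forall x, exists L, forall y, `|y| <= `|x| + 1 -> `|f x - f y| <= L * `|x - y|) ->
  continuous f.
Proof.
move=> fL x; have [L xL] := fL x; apply/cvgrPdist_lt => e e0.
have L1 : 0 < `|L| + 1 by rewrite ltr_wpDl.
near=> y.
have yx : `|y| <= `|x| + 1.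
  rewrite -(subrK x y) addrC; apply: le_trans (ler_normD _ _) _; rewrite lerD2l.
  by rewrite distrC ltW//; near: y; apply: cvgr_dist_lt => //; exact: cvg_id.
apply: le_lt_trans (xL _ yx) _.
apply: (@le_lt_trans _ _ ((`|L| + 1) * `|x - y|)).
  by rewrite ler_wpM2r// (le_trans (ler_norm _))// lerDl.
rewrite -ltr_pdivlMl//; near: y.
by apply: cvgr_dist_lt; [exact: cvg_id|rewrite mulr_gt0 ?invr_gt0].
Unshelve. all: by end_near. Qed.

Lemma lipschitz_continuous (V W : normedModType R) (f : V -> W) (L : R) :
  (forall x y, `|f x - f y| <= L * `|x - y|) -> continuous f.
Proof. by move=> fL; apply: locally_lipschitz_continuous => x; exists L. Qed.

Lemma continuous_dotrV n (w : 'rV[R]_n) : continuous (fun c => dotrV c w).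
Proof.
apply: (@lipschitz_continuous _ _ _ (norm1 w)) => c d.
by rewrite -dotrVBl ler_dotrV.
Qed.

(** The map adds [t k] on the fiber of [key] above [k] and, by the second
    hypothesis, keeps that fiber globally invariant; summing translation
    invariance over the countably many fibers gives the inequality. *)
Lemma countable_fiber_translations n (K : countType)
    (key : 'rV[R]_n -> K) (t : K -> 'rV[R]_n) :
  (forall k, measurable (key @^-1` [set k] : set (borel R n))) ->
  (forall c k, key (c + t k) = key c) ->
  forall A : set (borel R n), measurable A ->
  measurable ((fun c => c + t (key c)) @^-1` A : set (borel R n)) /\
  (lebesgue_rV R n ((fun c => (c + t (key c))%R) @^-1` A)
    <= lebesgue_rV R n A)%E.
Proof.
move=> mkey key_t A mA.
pose F (i : nat) : set (borel R n) := fun c => pickle (key c) = i.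
have FE i : F i = if unpickle i is Some k then
    (if pickle (k : K) == i then key @^-1` [set k] else set0) else set0.
  apply/seteqP; split => c; rewrite /F.
    by move=> <-; rewrite pickleK eqxx.
  case: (unpickle i) => // k; case: eqP => // <-; first by move=> /= ->.
have mF i : measurable (F i).
  by rewrite FE; case: unpickle => // k; case: ifPn.
have tF : trivIset setT F.
  by move=> i j _ _ [c [/= <- <-]].
have UF : \bigcup_i F i = setT.
  by rewrite -subTset => c _; exists (pickle (key c)).
have decomp (B : set (borel R n)) : measurable B ->
    lebesgue_rV R n B = (\sum_(i <oo) lebesgue_rV R n (B `&` F i))%E.
  move=> mB; rewrite -{1}(setIT B) -UF setI_bigcupr measure_semi_bigcup//.
  - by move=> i; exact: measurableI.
  - exact: trivIset_setIl.
  - by rewrite -setI_bigcupr; apply: measurableI => //; rewrite UF.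
set P := _ @^-1` A.
pose G i : set (borel R n) := if unpickle i is Some k then
  (fun c : 'rV[R]_n => c + t k) @^-1` (A `&` F i) else set0.
have PF i : P `&` F i = G i.
  rewrite /G; case E : (unpickle i) => [k|]; last first.
    by rewrite FE E setI0.
  apply/seteqP; split => c; rewrite /P /F /=.
    by move=> [Ac]; rewrite key_t => ci; split => //; move: E; rewrite -ci pickleK => -[<-].
  by rewrite key_t => -[Ac ci]; split => //; move: E Ac; rewrite -ci pickleK => -[<-].
have mG i : measurable (G i).
  rewrite /G; case: unpickle => // k; rewrite -[X in measurable X]setTI.
  by apply: measurable_translate => //; exact: measurableI.
have mP : measurable (P : set (borel R n)).
  have -> : P = \bigcup_i (G i).
    by rewrite -[LHS]setIT -UF setI_bigcupr; apply: eq_bigcupr => i _; exact: PF.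
  exact: bigcup_measurable.
split=> //; rewrite (decomp P mP) (decomp A mA); apply: lee_nneseries => // i _.
rewrite PF /G; case: unpickle => [k|]; last by rewrite measure0.
by rewrite lebesgue_rV_translate//; exact: measurableI.
Qed.

(** Rounding [dotrV c w] to a multiple of 1/(k+1) before applying [g] makes the
    displacement constant on slabs. As [v] is orthogonal to [w], the displacement
    maps each slab into itself, so the rounded maps are covered by
    [countable_fiber_translations]; they converge to the shear. *)
Lemma vol_nonincr_shear n (g : R -> R) (L : R) (w v : 'rV[R]_n) :
  (forall x y, `|g x - g y| <= L * `|x - y|) -> dotrV v w = 0 ->
  vol_nonincr (fun c => c + g (dotrV c w) *: v).
Proof.
move=> gL vw U oU.
have mU : measurable (U : set (borel R n)) by exact: sub_sigma_algebra.
pose fl (k : nat) (x : R) : R := (Num.floor (x * k.+1%:R))%:~R / k.+1%:R.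
(* [fl k] rounds down to the grid of mesh 1/(k+1) *)
have flP k x : `|fl k x - x| <= k.+1%:R^-1.
  have k0 : 0 < k.+1%:R :> R by rewrite ltr0n.
  rewrite -(ler_pM2r k0) mulVf ?gt_eqF// -[X in _ * X <= _](gtr0_norm k0) -normrM mulrBl.
  rewrite /fl mulfVK ?gt_eqF// distrC ger0_norm ?subr_ge0 ?floor_le//.
  by rewrite lerBlDl; apply/ltW; rewrite (lt_le_trans (floorD1_gt _))// intrD.
have Sc : continuous (fun c : 'rV[R]_n => c + g (dotrV c w) *: v).
  apply: (@lipschitz_continuous _ _ _ (1 + `|L| * norm1 w * `|v|)) => c d.
  rewrite opprD addrACA -scalerBl mulrDl mul1r.
  apply: le_trans (ler_normD _ _) _; rewrite lerD2l normrZ.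
  rewrite mulrAC ler_wpM2r//.
  apply: le_trans (gL _ _) _; rewrite -dotrVBl.
  apply: (@le_trans _ _ (`|L| * `|dotrV (c - d) w|)).
    by rewrite ler_wpM2r// ler_norm.
  by rewrite -mulrA ler_wpM2l// ler_dotrV.
pose key k (c : 'rV[R]_n) : int := Num.floor (dotrV c w * k.+1%:R).
pose t k (z : int) := g (z%:~R / k.+1%:R) *: v.
pose S_ k (c : 'rV[R]_n) := c + t k (key k c).
have mkey k z : measurable (key k @^-1` [set z] : set (borel R n)).
  have -> : key k @^-1` [set z] = (fun c => dotrV c w) @^-1`
      `[z%:~R / k.+1%:R, (z + 1)%:~R / k.+1%:R[.
    apply/seteqP; split => c; rewrite /key /= in_itv/= ler_pdivrMr// ltr_pdivlMr//.
      by move=> <-; exact: floor_itv.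
    by move=> /floor_def.
  rewrite -[X in measurable X]setTI; apply: continuous_measurable_rV => //.
  exact: continuous_dotrV.
have key_t k c z : key k (c + t k z) = key k c.
  by rewrite /key /t dotrVDl dotrVZl vw mulr0 addr0.
have SA k := @countable_fiber_translations n int (key k) (t k) (mkey k) (key_t k).
rewrite -[X in lebesgue_rV R n X]setTI.
apply: (@vol_nonincr_limit n setT S_) => //.
- by move=> k; case: (SA k U mU).
- by move=> k; case: (SA k U mU).
- move=> c _; apply/cvgrPdist_lt => e e0.
  have D0 : 0 < `|L| * `|v| + 1 by rewrite ltr_wpDl// mulr_ge0.
  near=> k; rewrite /S_ /t opprD addrACA subrr add0r -scalerBl normrZ.
  apply: (@le_lt_trans _ _ ((`|L| * `|v| + 1) * k.+1%:R^-1)).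
    rewrite mulrDl mul1r ler_wpDr// mulrAC ler_wpM2r//.
    apply: le_trans (gL _ _) _; apply: (@le_trans _ _ (`|L| * `|fl k (dotrV c w) - dotrV c w|)).
      by rewrite distrC ler_wpM2r// ler_norm.
    by rewrite ler_wpM2l.
  rewrite -ltr_pdivlMl//; near: k.
  have e1 : 0 < (`|L| * `|v| + 1)^-1 * e by rewrite mulr_gt0 ?invr_gt0.
  exact: (near_infty_natSinv_lt (PosNum e1)).
- by rewrite -[X in measurable X]setTI; exact: continuous_measurable_rV_rV.
Unshelve. all: by end_near. Qed.

End lebesgue_rV_theory.

(** * Approximate Euler chains and Lie splitting *)
Section euler.
Context {R : realType} {n : nat}.
Local Notation E := 'rV[R]_n.
Implicit Types (X : E -> E) (u : R -> E).

(** A sequence of points that follows the Euler scheme for [X] with time step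
    [h], up to a local error of second order. Samples of solutions and iterates of
    the splitting scheme are both of this kind, so one comparison lemma yields
    convergence, uniqueness and continuous dependence. *)
Definition euler_chain X (h C : R) (y : nat -> E) :=
  forall k, `|y k.+1 - y k - h *: X (y k)| <= C * h ^+ 2.

(** Discrete Gronwall inequality: the distance satisfies
    e_(k+1) <= (1 + L |h|) e_k + 2 C h^2, and 1 + L |h| <= exp (L |h|). *)
Lemma euler_chain_close X (L h C : R) (y z : nat -> E) :
  0 <= L -> (forall c d, `|X c - X d| <= L * `|c - d|) ->
  0 <= C -> euler_chain X h C y -> euler_chain X h C z ->
  forall k, `|y k - z k| <=
    expR (L * `|h| * k%:R) * (`|y 0%N - z 0%N| + 2 * C * h ^+ 2 * k%:R).
Proof.
move=> L0 XL C0 hy hz; elim=> [|k IH].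
  by rewrite !mulr0 expR0 mul1r addr0.
set e0 := `|y 0%N - z 0%N| in IH *.
have step : `|y k.+1 - z k.+1| <= (1 + L * `|h|) * `|y k - z k| + 2 * C * h ^+ 2.
  rewrite (_ : y k.+1 - z k.+1 = (y k - z k) + h *: (X (y k) - X (z k)) +
     ((y k.+1 - y k - h *: X (y k)) - (z k.+1 - z k - h *: X (z k)))); last first.
    rewrite scalerBr; apply/rowP => i; rewrite !mxE; ring.
  apply: le_trans (ler_normD _ _) _; apply: lerD; last first.
    apply: le_trans (ler_normB _ _) _; have := lerD (hy k) (hz k); lra.
  apply: le_trans (ler_normD _ _) _; rewrite mulrDl mul1r lerD2l normrZ.
  by rewrite mulrAC mulrC ler_wpM2r.
apply: le_trans step _.
have Lh0 : 0 <= L * `|h| by rewrite mulr_ge0.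
have -> : L * `|h| * k.+1%:R = L * `|h| + L * `|h| * k%:R.
  by rewrite -natr1; ring.
rewrite expRD.
have e1 := expR_ge1Dx (L * `|h|).
have D0 : 0 <= 2 * C * h ^+ 2 by rewrite mulr_ge0 ?sqr_ge0// mulr_ge0.
apply: (@le_trans _ _ (expR (L * `|h|) * (expR (L * `|h| * k%:R) *
   (e0 + 2 * C * h ^+ 2 * k%:R)) + 2 * C * h ^+ 2)).
  rewrite lerD2r; apply: ler_pM => //; first by rewrite addr_ge0.
rewrite -natr1; set D := 2 * C * h ^+ 2 in D0 *.
have PQ : 1 <= expR (L * `|h|) * expR (L * `|h| * k%:R).
  by rewrite -expRD -expR0 ler_expR addr_ge0 ?mulr_ge0.
rewrite -subr_ge0.
rewrite [leRHS](_ : _ = D * (expR (L * `|h|) * expR (L * `|h| * k%:R) - 1)); last by ring.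
by rewrite mulr_ge0// subr_ge0.
Qed.

Definition solves X u := forall t, is_derive t (1 : R) u (X (u t)).

Lemma is_derive_coord (u : R -> E) t d i : is_derive t (1 : R) u d ->
  is_derive t (1 : R) (fun s => u s ord0 i) (d ord0 i).
Proof.
move=> [du <-]; apply: DeriveDef; first by move/derivable_mxP : du; exact.
by rewrite derive_mx// mxE.
Qed.

Lemma is_derive_along (u : R -> E) X (s h r : R) i : solves X u ->
  is_derive r (1 : R) (fun r => u (s + r * h) ord0 i) (h * X (u (s + r * h)) ord0 i).
Proof.
move=> Xu.
have aff : is_derive r (1 : R) (fun r => s + r * h) h.
  rewrite (_ : (fun r => _) = cst s + (id * cst h)); last by apply/funext.
  by apply: is_derive_eq; rewrite scaler0 !add0r [LHS]mulr1.
have := @is_derive1_comp R (fun t => u t ord0 i) _ r _ _ (is_derive_coord i (Xu _)) aff.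
by rewrite mulrC.
Qed.

(** The mean value theorem is used on [0, 1] for r |-> u (s + r h), which treats
    both signs of the time step at once. *)
Lemma solves_mvt (u : R -> E) X (s h : R) i : solves X u ->
  exists2 r, 0 <= r <= 1 &
  u (s + h) ord0 i - u s ord0 i = h * X (u (s + r * h)) ord0 i.
Proof.
move=> Xu.
have dphi r := is_derive_along s h r i Xu.
have [|r r01] := @MVT_segment R _ _ 0 1 ler01 (fun r _ => dphi r).
  apply: continuous_subspaceT => r.
  by apply/differentiable_continuous/derivable1_diffP; have [] := dphi r.
rewrite mul1r mul0r addr0 subr0 mulr1 => ->.
by exists r => //; move: r01; rewrite in_itv.
Qed.

Lemma solves_lipschitz (u : R -> E) X (B : R) : 0 <= B -> solves X u ->
  (forall s, `|X (u s)| <= B) -> forall s h, `|u (s + h) - u s| <= B * `|h|.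
Proof.
move=> B0 Xu uB s h; apply: ler_norm_rV => [|i]; first by rewrite mulr_ge0.
have [r _] := solves_mvt s h i Xu; rewrite !mxE => ->.
by rewrite normrM mulrC ler_wpM2r// (le_trans (ler_coord _ _)).
Qed.

(** The mean value theorem bounds the local error of coordinate [i] by
    |h| |X (u (s + r h)) - X (u s)|, and [u] moves by at most B |h|. *)
Lemma solves_euler_chain (u : R -> E) X (L B h : R) :
  0 <= L -> 0 <= B -> (forall c d, `|X c - X d| <= L * `|c - d|) ->
  (forall s, `|X (u s)| <= B) -> solves X u ->
  euler_chain X h (L * B) (fun k => u (k%:R * h)).
Proof.
move=> L0 B0 XL uB Xu k.
apply: ler_norm_rV => [|i]; first by rewrite mulr_ge0 ?sqr_ge0// mulr_ge0.
have -> : k.+1%:R * h = k%:R * h + h by rewrite -natr1 mulrDl mul1r.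
set s := k%:R * h.
have [r /andP[r0 r1]] := solves_mvt s h i Xu; rewrite !mxE => ->.
rewrite -mulrBr normrM -real_normK ?num_real// expr2 mulrA.
rewrite mulrC ler_wpM2r//.
have := ler_coord (X (u (s + r * h)) - X (u s)) i; rewrite !mxE => /le_trans; apply.
apply: le_trans (XL _ _) _; rewrite -mulrA ler_wpM2l//.
apply: le_trans (solves_lipschitz B0 Xu uB _ _) _.
by rewrite ler_wpM2l// normrM ger0_norm// ler_piMl.
Qed.

End euler.

Section splitting.
Context {R : realType} {n : nat} {I : Type}.
Local Notation E := 'rV[R]_n.
Variables (F : I -> E -> E) (L B : R).
Hypotheses (L0 : 0 <= L) (B0 : 0 <= B).
Hypothesis FL : forall i c d, `|F i c - F i d| <= L * `|c - d|.
Hypothesis FB : forall i c, `|F i c| <= B.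
Implicit Types (s : seq I) (h t : R) (c d : E).

Definition field_sum s c := \sum_(i <- s) F i c.

(** One step of Lie splitting: the fields act in turn, each for time [h] along
    its value at the current point. *)
Definition split_step h s c := foldl (fun d i => d + h *: F i d) c s.

Lemma field_sum_lipschitz s c d :
  `|field_sum s c - field_sum s d| <= L * (size s)%:R * `|c - d|.
Proof.
rewrite /field_sum -sumrB; elim: s => [|i s IH].
  by rewrite big_nil normr0 mulr0 mul0r.
rewrite big_cons; apply: le_trans (ler_normD _ _) _.
apply: le_trans (lerD (FL _ _ _) IH) _.
by rewrite /= -natr1 le_eqVlt; apply/orP; left; apply/eqP; ring.
Qed.

Lemma field_sum_bounded s c : `|field_sum s c| <= B * (size s)%:R.
Proof.
rewrite /field_sum; elim: s => [|i s IH]; first by rewrite big_nil normr0 mulr0.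
rewrite big_cons; apply: le_trans (ler_normD _ _) _.
apply: le_trans (lerD (FB _ _) IH) _.
by rewrite /= -natr1 le_eqVlt; apply/orP; left; apply/eqP; ring.
Qed.

(** Each field is evaluated at a point that the previous fields have moved by
    O(h), which costs O(h^2) by the Lipschitz bound. *)
Lemma split_step_consistent h s c :
  `|split_step h s c - c - h *: field_sum s c|
    <= L * B * (size s)%:R ^+ 2 * h ^+ 2.
Proof.
elim: s c => [|i s IH] c.
  by rewrite /field_sum big_nil /= subrr scaler0 subrr normr0 expr0n/= mulr0 mul0r.
rewrite /=; set c1 := c + h *: F i c.
have -> : split_step h s c1 - c - h *: field_sum (i :: s) c =
    (split_step h s c1 - c1 - h *: field_sum s c1) +
    h *: (field_sum s c1 - field_sum s c).
  by rewrite /field_sum big_cons /c1; apply/rowP => j; rewrite !mxE; ring.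
apply: le_trans (ler_normD _ _) _.
have c1c : `|c1 - c| <= B * `|h|.
  by rewrite /c1 addrC addKr normrZ mulrC ler_wpM2r.
have h2 : `|h *: (field_sum s c1 - field_sum s c)| <= L * B * (size s)%:R * h ^+ 2.
  rewrite normrZ -(real_normK (num_real h)) expr2 mulrA mulrC ler_wpM2r//.
  apply: le_trans (field_sum_lipschitz _ _ _) _.
  by rewrite -!mulrA ler_wpM2l// (mulrCA B) ler_wpM2l.
apply: le_trans (lerD (IH c1) h2) _.
rewrite -mulrDl ler_wpM2r ?sqr_ge0// -!mulrA -!mulrDr !ler_wpM2l//.
rewrite -natr1 -subr_ge0 (_ : _ - _ = (size s)%:R + 1); first by rewrite addr_ge0.
ring.
Qed.

Lemma split_step_continuous h s : continuous (split_step h s).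
Proof.
elim: s => [|i s IH] c /=; first exact: cvg_id.
have ic : continuous (fun d => d + h *: F i d).
  apply: (@lipschitz_continuous _ _ _ _ (1 + `|h| * L)) => x y.
  rewrite opprD addrACA -scalerBr mulrDl mul1r.
  apply: le_trans (ler_normD _ _) _; rewrite lerD2l normrZ -mulrA.
  by rewrite ler_wpM2l.
exact: (@continuous_comp _ _ _ (fun d => d + h *: F i d) (split_step h s) c
  (ic c) (IH _)).
Qed.

Lemma iter_continuous (f : E -> E) k : continuous f -> continuous (iter k f).
Proof.
move=> cf; elim: k => [|k IH] c; first exact: cvg_id.
exact: (@continuous_comp _ _ _ (iter k f) f c (IH c) (cf _)).
Qed.

Lemma vol_nonincr_split_step h s :
  (forall i, vol_nonincr (fun c => c + h *: F i c)) -> vol_nonincr (split_step h s).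
Proof.
move=> Fv; elim: s => [|i s IH] /=; first by [].
exact: (@vol_nonincr_comp _ _ (fun d => d + h *: F i d) (split_step h s)
  (@split_step_continuous h s) (Fv i) IH).
Qed.

Lemma vol_nonincr_iter (f : E -> E) k : continuous f -> vol_nonincr f ->
  vol_nonincr (iter k f).
Proof.
move=> cf fv; elim: k => [|k IH]; first by [].
exact: (@vol_nonincr_comp _ _ (iter k f) f cf IH fv).
Qed.

Let K s := (size s)%:R : R.

(** With [m.+1] steps of length t / (m+1) the chains end at time [t], and the
    accumulated error is O(1/m). *)
Lemma euler_chain_end_close s t (C : R) (y z : nat -> nat -> E) m : 0 <= C ->
  euler_chain (field_sum s) (t / m.+1%:R) C (y m) ->
  euler_chain (field_sum s) (t / m.+1%:R) C (z m) ->
  `|y m m.+1 - z m m.+1| <= expR (L * K s * `|t|) *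
    (`|y m 0%N - z m 0%N| + 2 * C * t ^+ 2 * m.+1%:R^-1).
Proof.
move=> C0 hy hz; have LK0 : 0 <= L * K s by rewrite mulr_ge0.
have := euler_chain_close LK0 (@field_sum_lipschitz s) C0 hy hz m.+1.
have m0 : m.+1%:R != 0 :> R by rewrite pnatr_eq0.
rewrite normrM normfV (ger0_norm (ler0n _ _)).
by rewrite (_ : L * K s * _ * _ = L * K s * `|t|) 1?(_ : 2 * C * _ * _ = 2 * C * t ^+ 2 * m.+1%:R^-1)//;
   field.
Qed.

Let solves_chain s u h : solves (field_sum s) u ->
  euler_chain (field_sum s) h (L * B * K s ^+ 2) (fun k => u (k%:R * h)).
Proof.
move=> su.
have := @solves_euler_chain _ _ u (field_sum s) (L * K s) (B * K s) h.
rewrite (_ : L * K s * (B * K s) = L * B * K s ^+ 2); last by rewrite /K; ring.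
apply; rewrite ?mulr_ge0//; first exact: field_sum_lipschitz.
by move=> r; exact: field_sum_bounded.
Qed.

Let C0 s : 0 <= L * B * K s ^+ 2.
Proof. by rewrite mulr_ge0 ?sqr_ge0// mulr_ge0. Qed.

(** Compare the samples of both solutions and let the mesh tend to zero. *)
Lemma solves_close s u v t : solves (field_sum s) u -> solves (field_sum s) v ->
  `|u t - v t| <= expR (L * K s * `|t|) * `|u 0 - v 0|.
Proof.
move=> su sv; apply/ler_addgt0Pr => e e0.
set A := expR _; pose D := A * (2 * (L * B * K s ^+ 2) * t ^+ 2).
have D0 : 0 <= D.
  by rewrite mulr_ge0 ?expR_ge0// mulr_ge0 ?sqr_ge0// mulr_ge0 ?C0.
have [m _ /(_ m (leqnn m)) /= hm] := near_infty_natSinv_lt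
  (PosNum (divr_gt0 e0 (ltr_pwDr ltr01 D0))).
have := @euler_chain_end_close s t _ (fun m k => u (k%:R * (t / m.+1%:R)))
  (fun m k => v (k%:R * (t / m.+1%:R))) m (C0 s) (solves_chain _ su) (solves_chain _ sv).
rewrite !mul0r (mulrC m.+1%:R) divfK ?pnatr_eq0// => /le_trans; apply.
rewrite mulrDr lerD2l mulrA -/D.
apply: (@le_trans _ _ ((D + 1) * m.+1%:R^-1)).
  by rewrite ler_wpM2r ?invr_ge0// lerDl.
by rewrite mulrC -ler_pdivlMr ?ltr_pwDr// ltW.
Qed.

Lemma split_step_cvg s u t : solves (field_sum s) u ->
  iter m.+1 (split_step (t / m.+1%:R) s) (u 0) @[m --> \oo] --> u t.
Proof.
move=> su; apply/cvgrPdist_le => e e0.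
set A := expR (L * K s * `|t|); pose D := A * (2 * (L * B * K s ^+ 2) * t ^+ 2).
have D0 : 0 <= D.
  by rewrite mulr_ge0 ?expR_ge0// mulr_ge0 ?sqr_ge0// mulr_ge0 ?C0.
have hm := near_infty_natSinv_lt (PosNum (divr_gt0 e0 (ltr_pwDr ltr01 D0))).
near=> m.
have := @euler_chain_end_close s t _ (fun m k => u (k%:R * (t / m.+1%:R)))
  (fun m k => iter k (split_step (t / m.+1%:R) s) (u 0)) m (C0 s) (solves_chain _ su).
rewrite !mul0r (mulrC m.+1%:R) divfK ?pnatr_eq0// => /(_ _)/le_trans; apply.
  by move=> k; exact: split_step_consistent.
rewrite subrr normr0 add0r mulrA -/D.
apply: (@le_trans _ _ ((D + 1) * m.+1%:R^-1)).
  by rewrite ler_wpM2r ?invr_ge0// lerDl.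
rewrite mulrC -ler_pdivlMr ?ltr_pwDr// ltW//.
by near: m.
Unshelve. all: by end_near. Qed.

(** The splitting scheme is a composition of maps [c + h *: F i c]; each of them
    does not increase the measure of open sets, and the scheme converges to the
    flow at the points of [D]. *)
Lemma vol_flow_le s (T : E -> E) t (D : set (borel R n)) (U : set E) :
  (forall h i, vol_nonincr (fun c => c + h *: F i c)) ->
  measurable D ->
  (forall c, D c -> exists u, [/\ solves (field_sum s) u, u 0 = c & u t = T c]) ->
  open U -> measurable (T @^-1` U : set (borel R n)) ->
  (lebesgue_rV R n (D `&` T @^-1` U) <= lebesgue_rV R n U)%E.
Proof.
move=> Fv mD DT oU mTU.
apply: (@vol_nonincr_limit _ _ _
  (fun m => iter m.+1 (split_step (t / m.+1%:R) s))) => //.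
- move=> m; rewrite -[X in measurable X]setTI.
  apply: continuous_measurable_rV_rV => //; last exact: sub_sigma_algebra.
  by apply: iter_continuous; exact: split_step_continuous.
- move=> m; apply: vol_nonincr_iter => //; first exact: split_step_continuous.
  exact: vol_nonincr_split_step.
- by move=> c /DT[u [su <- <-]]; exact: split_step_cvg.
Qed.

End splitting.

(** * Volume preservation for flows of sums of shears *)
Section clamp.
Context {R : realType}.
Implicit Types x y M : R.

(** Projection of the line onto [- M, M]. *)
Definition clamp M x := if x <= - M then - M else if M <= x then M else x.

Lemma clamp_norm M x : 0 <= M -> `|clamp M x| <= M.
Proof.
move=> M0; rewrite /clamp ler_norml.
by case: (leP x (- M)); case: (leP M x); lra.
Qed.

Lemma clamp_id M x : `|x| <= M -> clamp M x = x.
Proof.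
rewrite /clamp ler_norml.
by case: (leP x (- M)); case: (leP M x); lra.
Qed.

Lemma clamp_lipschitz M x y : 0 <= M -> `|clamp M x - clamp M y| <= `|x - y|.
Proof.
move=> M0; rewrite /clamp.
case: (leP x (- M)); case: (leP M x); case: (leP y (- M)); case: (leP M y);
 case: (ger0P (x - y)); rewrite ?ler_norml; lra.
Qed.

End clamp.

Section shear_flow.
Context {R : realType} {n : nat} {I : finType}.
Local Notation E := 'rV[R]_n.
Variables (g : I -> R -> R) (w v : I -> E).

Definition shear_field (c : E) : E := \sum_i g i (dotrV c (w i)) *: v i.

Hypothesis vw : forall i, dotrV (v i) (w i) = 0.
Hypothesis gL : forall i M, exists2 L, 0 <= L &
  forall x y, `|x| <= M -> `|y| <= M -> `|g i x - g i y| <= L * `|x - y|.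

(** Clamping the argument of every profile [g i] gives bounded Lipschitz fields
    that are still shears and that agree with the original ones on the ball of
    radius [rho]; orbits that stay in this ball do not see the difference. *)
Lemma clamped_shears rho : exists F : I -> E -> E, exists L B, [/\ 0 <= L, 0 <= B,
  forall i c d, `|F i c - F i d| <= L * `|c - d|,
  forall i c, `|F i c| <= B &
  (forall h i, vol_nonincr (fun c => c + h *: F i c)) /\
  forall c, `|c| <= rho -> field_sum F (index_enum I) c = shear_field c].
Proof.
pose M := (\sum_i norm1 (w i)) * `|rho|.
have W0 : 0 <= \sum_i norm1 (w i) by apply: sumr_ge0 => i _; exact: norm1_ge0.
have M0 : 0 <= M by rewrite mulr_ge0.
have leM i : norm1 (w i) * `|rho| <= M.
  rewrite ler_wpM2r// (bigD1 i)//= lerDl.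
  by apply: sumr_ge0 => j _; exact: norm1_ge0.
pose Lg i := s2val (cid2 (gL i M)).
have Lg0 i : 0 <= Lg i by rewrite /Lg; case: cid2.
have LgP i x y : `|g i (clamp M x) - g i (clamp M y)| <= Lg i * `|x - y|.
  rewrite /Lg; case: cid2 => l l0 /= lP.
  apply: le_trans (lP _ _ (clamp_norm _ M0) (clamp_norm _ M0)) _.
  by rewrite ler_wpM2l// clamp_lipschitz.
pose F i c := g i (clamp M (dotrV c (w i))) *: v i.
pose Lf i := Lg i * norm1 (w i) * `|v i|.
have Lf0 i : 0 <= Lf i by rewrite mulr_ge0// mulr_ge0// norm1_ge0.
pose Bf i := (`|g i (clamp M 0)| + Lg i * M) * `|v i|.
have Bf0 i : 0 <= Bf i by rewrite mulr_ge0// addr_ge0// mulr_ge0.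
exists F, (\sum_i Lf i), (\sum_i Bf i); split.
- by apply: sumr_ge0 => i _.
- by apply: sumr_ge0 => i _.
- move=> i c d; apply: (@le_trans _ _ (Lf i * `|c - d|)).
    rewrite /F -scalerBl normrZ /Lf mulrAC ler_wpM2r//.
    apply: le_trans (LgP _ _ _) _; rewrite -mulrA ler_wpM2l//.
    by rewrite -dotrVBl ler_dotrV.
  by rewrite ler_wpM2r// (bigD1 i)//= lerDl; apply: sumr_ge0 => j _.
- move=> i c; apply: (@le_trans _ _ (Bf i)); last first.
    by rewrite (bigD1 i)//= lerDl; apply: sumr_ge0 => j _.
  rewrite /F normrZ ler_wpM2r//.
  set x := dotrV c (w i).
  rewrite -(subrK (g i (clamp M 0)) (g i (clamp M x))) addrC.
  apply: le_trans (ler_normD _ _) _; rewrite lerD2l.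
  rewrite /Lg; case: cid2 => l l0 /= lP.
  apply: le_trans (lP _ _ (clamp_norm _ M0) (clamp_norm _ M0)) _.
  have c0 : clamp M 0 = 0 by rewrite clamp_id// normr0.
  by rewrite ler_wpM2l// c0 subr0 clamp_norm.
split.
  move=> h i.
  have := @vol_nonincr_shear R n (fun x => h * g i (clamp M x)) (`|h| * Lg i) (w i) (v i).
  under eq_fun do rewrite -scalerA.
  apply => // x y.
  by rewrite -mulrBr normrM -mulrA ler_wpM2l.
move=> c cr; apply: eq_bigr => i _; rewrite /F clamp_id//.
apply: le_trans (ler_dotrV _ _) _; apply: le_trans (leM i).
by rewrite ler_wpM2l ?norm1_ge0// (le_trans cr)// ler_norm.
Qed.

Lemma shear_solutions_close rho : exists K : R, forall u u' : R -> E,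
  solves shear_field u -> solves shear_field u' ->
  (forall s, `|u s| <= rho) -> (forall s, `|u' s| <= rho) ->
  forall t, `|u t - u' t| <= expR (K * `|t|) * `|u 0 - u' 0|.
Proof.
have [F [L [B [L0 B0 FL FB [Fv FX]]]]] := clamped_shears rho.
exists (L * (size (index_enum I))%:R) => u u' su su' ur u'r t.
apply: (solves_close L0 B0 FL FB).
- by move=> s; rewrite FX//; exact: su.
- by move=> s; rewrite FX//; exact: su'.
Qed.

Variable Phi : R -> E -> E.
Hypothesis Phi0 : forall c, Phi 0 c = c.
Hypothesis PhiX : forall c, solves shear_field (Phi^~ c).
Hypothesis Phi_sq : forall t c, dotrV (Phi t c) (Phi t c) = dotrV c c.

Lemma dotrV_ge0 (c : E) : 0 <= dotrV c c.
Proof. by apply: sumr_ge0 => i _; rewrite -expr2 sqr_ge0. Qed.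

Lemma ler_norm_dotrV (c : E) rho : 0 <= rho -> dotrV c c <= rho ^+ 2 -> `|c| <= rho.
Proof.
move=> r0 cr; apply: ler_norm_rV => // i.
rewrite -(@ler_pXn2r _ 2) ?nnegrE// real_normK ?num_real//.
apply: le_trans cr; rewrite /dotrV (bigD1 i)//= expr2 lerDl.
by apply: sumr_ge0 => j _; rewrite -expr2 sqr_ge0.
Qed.

Lemma dotrV_le_norm (c : E) : dotrV c c <= ((n%:R + 1) * `|c|) ^+ 2.
Proof.
apply: le_trans (ler_norm _) _; apply: le_trans (ler_dotrV _ _) _.
have h : norm1 c <= (n%:R + 1) * `|c|.
  apply: (@le_trans _ _ (\sum_(i < n) `|c|)).
    by apply: ler_sum => i _; exact: ler_coord.
  by rewrite sumr_const card_ord mulrDl mul1r mulr_natl lerDl.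
rewrite expr2; apply: ler_pM => //; first exact: norm1_ge0.
by rewrite mulrDl mul1r lerDr mulr_ge0.
Qed.

Definition dot_ball (rho : R) : set (borel R n) := [set c | dotrV c c <= rho].

Lemma measurable_dot_ball rho : measurable (dot_ball rho).
Proof.
rewrite -[X in measurable X]setTI.
have mq : measurable_fun setT (fun c : borel R n => dotrV c c).
  by apply: measurable_sum => i; apply: measurable_funM; exact: measurable_coord.
have -> : dot_ball rho = (fun c : borel R n => dotrV c c) @^-1` `]-oo, rho].
  by apply/seteqP; split => c /=; rewrite in_itv.
by apply: mq.
Qed.

Let orbit_le rho c : 0 <= rho -> dotrV c c <= rho ^+ 2 ->
  forall s, `|Phi s c| <= rho.
Proof. by move=> r0 cr s; apply: ler_norm_dotrV => //; rewrite Phi_sq. Qed.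

Lemma flow_continuous t : continuous (Phi t).
Proof.
apply: locally_lipschitz_continuous => c.
pose rho := (n%:R + 1) * (`|c| + 1).
have rho0 : 0 <= rho by rewrite mulr_ge0 ?addr_ge0.
have [K HK] := shear_solutions_close rho.
have small (d : E) : `|d| <= `|c| + 1 -> dotrV d d <= rho ^+ 2.
  move=> dc; apply: le_trans (dotrV_le_norm _) _.
  by rewrite ler_pXn2r ?nnegrE ?mulr_ge0 ?addr_ge0// ler_wpM2l ?addr_ge0.
exists (expR (K * `|t|)) => d dc.
have cc : `|c| <= `|c| + 1 by rewrite lerDl.
have := HK _ _ (PhiX c) (PhiX d) (orbit_le rho0 (small _ cc))
  (orbit_le rho0 (small _ dc)) t.
by rewrite !Phi0.
Qed.

Lemma solves_shift (X : E -> E) (u : R -> E) a : solves X u ->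
  solves X (fun s => u (s + a)).
Proof.
move=> Xu s; have [du ue] := Xu (s + a).
have q : (fun h : R => h^-1 *: (((fun s => u (s + a)) \o shift s) (h *: 1) - u (s + a)))
    = (fun h : R => h^-1 *: ((u \o shift (s + a)) (h *: 1) - u (s + a))).
  by apply/funext => h /=; rewrite addrA.
by apply: DeriveDef; [rewrite /derivable q|rewrite /derive q].
Qed.

(** Uniqueness of solutions: [s |-> Phi (s - t) c] solves the equation and starts
    at [Phi (- t) c]. *)
Lemma flow_inv t c : Phi t (Phi (- t) c) = c.
Proof.
pose rho := (n%:R + 1) * `|c|.
have rho0 : 0 <= rho by rewrite mulr_ge0// addr_ge0.
have [K HK] := shear_solutions_close rho.
have := HK (fun s => Phi (s - t) c) (Phi^~ (Phi (- t) c))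
  (solves_shift _ (PhiX c)) (PhiX _).
have c1 := dotrV_le_norm c.
have c2 : dotrV (Phi (- t) c) (Phi (- t) c) <= rho ^+ 2 by rewrite Phi_sq.
move=> /(_ (fun s => orbit_le rho0 c1 _) (orbit_le rho0 c2) t).
rewrite sub0r !Phi0 !subrr Phi0 normr0 mulr0 normr_le0 subr_eq0.
by move=> /eqP.
Qed.

Lemma flow_preimage t (A : set E) : Phi t @` A = Phi (- t) @^-1` A.
Proof.
apply/seteqP; split => c /=.
  by move=> [d Ad <-]; rewrite -{2}(opprK t) flow_inv.
by move=> Ac; exists (Phi (- t) c) => //; exact: flow_inv.
Qed.

(** The orbits that start in a ball remain in it, so on that ball the flow is also
    the flow of the clamped fields. *)
Let vol_le_bounded t (U : set E) rho : 0 <= rho -> open U ->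
  (lebesgue_rV R n (dot_ball (rho ^+ 2)%R `&` Phi t @^-1` U)
     <= lebesgue_rV R n U)%E.
Proof.
move=> rho0 oU.
have [F [L [B [L0 B0 FL FB [Fv FX]]]]] := clamped_shears rho.
apply: (@vol_flow_le _ _ _ F L B L0 B0 FL FB (index_enum I) _ t) => //.
- exact: measurable_dot_ball.
- move=> c /= cr; exists (Phi^~ c); split => // s.
  by rewrite FX; [exact: PhiX|exact: orbit_le].
- rewrite -[X in measurable X]setTI; apply: continuous_measurable_rV_rV => //.
    exact: flow_continuous.
  exact: sub_sigma_algebra.
Qed.

Lemma measurable_flow t : measurable_fun setT (Phi t : borel R n -> borel R n).
Proof. by apply: continuous_measurable_rV_rV; exact: flow_continuous. Qed.

Let vol_le t (U : set E) : open U ->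
  (lebesgue_rV R n (Phi t @^-1` U) <= lebesgue_rV R n U)%E.
Proof.
move=> oU.
pose D (k : nat) : set (borel R n) := dot_ball (k%:R ^+ 2) `&` Phi t @^-1` U.
have mU : measurable (Phi t @^-1` U : set (borel R n)).
  rewrite -[X in measurable X]setTI; apply: measurable_flow => //.
  exact: sub_sigma_algebra.
have mD k : measurable (D k).
  apply: measurableI => //.
  exact: measurable_dot_ball.
have UD : \bigcup_k (D k) = Phi t @^-1` U.
  apply/seteqP; split => [c [k _ [_ ]]//|c Uc].
  have [k hk] : exists k : nat, (n%:R + 1) * `|c| <= k%:R.
    by exists (Num.truncn ((n%:R + 1) * `|c|)).+1; apply/ltW/truncnS_gt.
  exists k => //; split => //=; apply: le_trans (dotrV_le_norm _) _.
  by rewrite ler_pXn2r ?nnegrE ?mulr_ge0 ?addr_ge0.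
have := @nondecreasing_cvg_mu _ _ _ (lebesgue_rV R n) D mD.
rewrite UD => /(_ mU) cD.
have {}cD : lebesgue_rV R n \o D @ \oo --> lebesgue_rV R n (Phi t @^-1` U).
  apply: cD => j k jk; apply/subsetPset => c [/= cj Uc]; split => //=.
  by apply: (le_trans cj); rewrite ler_pXn2r ?nnegrE// ler_nat.
rewrite -(cvg_lim _ cD)//; apply: lime_le; first by apply/cvg_ex; eexists; exact: cD.
by apply: nearW => k; exact: vol_le_bounded.
Qed.

(** On an open set [U] one inequality is [vol_le] for time [t]; the other one is
    [vol_le] for time [- t] and the open set of points that [Phi t] sends to [U].
    Open sets form a generating class stable under intersection. *)
Theorem shear_flow_volume t (A : set (borel R n)) : measurable A ->
  lebesgue_rV R n (Phi t @^-1` A) = lebesgue_rV R n A.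
Proof.
move=> mA.
pose f : {mfun borel R n >-> borel R n} := HB.pack (Phi t : borel R n -> borel R n)
  (isMeasurableFun.Build _ _ _ _ _ (measurable_flow t)).
apply/esym/(@measure_unique _ R (borel R n) (@open 'rV[R]_n)
  (fun k => ball (0 : 'rV[R]_n) k%:R) erefl _ _ _
  (lebesgue_rV R n) (pushforward (lebesgue_rV R n) f)) => //.
- exact: openI.
- by move=> k; exact: ball_open.
- rewrite -subTset => c _; exists (Num.truncn `|c|).+1 => //.
  by rewrite -ball_normE /ball_/= sub0r normrN truncnS_gt.
- move=> U oU; rewrite /pushforward /=; apply/eqP; rewrite eq_le; apply/andP; split.
    have oV : open (Phi t @^-1` U) by move/continuousP: (@flow_continuous t); exact.
    have := vol_le (- t) oV; rewrite -comp_preimage.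
    by rewrite (_ : _ \o _ = id) ?preimage_id//; apply/funext => c /=; rewrite flow_inv.
  exact: vol_le.
- by move=> k; exact: lebesgue_rV_ball_lty.
Qed.

End shear_flow.

(** * Integrals of trigonometric functions and equispaced quadrature *)
Section circle_int_theory.
Context {R : realType}.
Implicit Types (f F : R -> R) (k l : int).

Let mu := @lebesgue_measure R.
Let per : set R := `[0, 2 * pi].

Lemma circle_integrable f : continuous f -> mu.-integrable per (EFin \o f).
Proof.
move=> cf; apply: continuous_compact_integrable; first exact: segment_compact.
exact: continuous_subspaceT.
Qed.

Lemma circle_intD f F : continuous f -> continuous F ->
  circle_int (fun x => f x + F x) = circle_int f + circle_int F.
Proof.
by move=> cf cF; apply: RintegralD => //; exact: circle_integrable.
Qed.

Lemma circle_intZ (a : R) f : continuous f ->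
  circle_int (fun x => a * f x) = a * circle_int f.
Proof. by move=> cf; apply: RintegralZl => //; exact: circle_integrable. Qed.

Lemma continuous_sum (J : Type) (s : seq J) (h : J -> R -> R) :
  (forall j, continuous (h j)) -> continuous (fun x => \sum_(j <- s) h j x).
Proof. by move=> ch; apply: continuous_big => //; exact: add_continuous. Qed.

Lemma circle_int_sum (J : Type) (s : seq J) (h : J -> R -> R) :
  (forall j, continuous (h j)) ->
  circle_int (fun x => \sum_(j <- s) h j x) = \sum_(j <- s) circle_int (h j).
Proof.
move=> ch; elim: s => [|j s IH].
  rewrite big_nil [LHS](_ : _ = circle_int (fun x => 0 * 0)).
    by rewrite circle_intZ ?mul0r// => x; exact: cvg_cst.
  by congr circle_int; apply/funext => x; rewrite big_nil mul0r.
rewrite big_cons -IH -circle_intD//; last exact: continuous_sum.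
by congr circle_int; apply/funext => x; rewrite big_cons.
Qed.

Lemma is_derive_continuous F f : (forall x : R, is_derive x (1 : R) F (f x)) ->
  continuous F.
Proof.
move=> dF x; apply/differentiable_continuous/derivable1_diffP.
by have [] := dF x.
Qed.

Lemma circle_int_derive F f : (forall x : R, is_derive x (1 : R) F (f x)) ->
  continuous f -> F (2 * pi) = F 0 -> circle_int f = 0.
Proof.
move=> dF cf F0.
have pi2 : 0 < 2 * pi :> R by rewrite mulr_gt0// pi_gt0.
have cF := is_derive_continuous dF.
rewrite /circle_int /Rintegral (@continuous_FTC2 _ f F)//.
- by rewrite F0 subee.
- exact: continuous_subspaceT.
- split.
  + by move=> x _; have [] := dF x.
  + exact/cvg_at_right_filter/cF.
  + exact/cvg_at_left_filter/cF.
- by move=> x _; rewrite derive1E; apply: derive_val.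
Qed.

Definition cosz k (x : R) := cos (k%:~R * x).
Definition sinz k (x : R) := sin (k%:~R * x).

Lemma is_derive_cosz k (x : R) :
  is_derive x (1 : R) (cosz k) (- (k%:~R * sinz k x)).
Proof.
have aff : is_derive x (1 : R) (fun y => k%:~R * y) (k%:~R).
  rewrite (_ : (fun y => _) = k%:~R \*: id); last by apply/funext.
  by apply: is_derive_eq; rewrite [LHS]mulr1.
have := @is_derive1_comp R cos _ x _ _ (is_derive_cos _) aff.
by rewrite mulrC mulrN.
Qed.

Lemma is_derive_sinz k (x : R) :
  is_derive x (1 : R) (sinz k) (k%:~R * cosz k x).
Proof.
have aff : is_derive x (1 : R) (fun y => k%:~R * y) (k%:~R).
  rewrite (_ : (fun y => _) = k%:~R \*: id); last by apply/funext.
  by apply: is_derive_eq; rewrite [LHS]mulr1.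
have := @is_derive1_comp R sin _ x _ _ (is_derive_sin _) aff.
by rewrite mulrC.
Qed.

Lemma continuous_cosz k : continuous (cosz k).
Proof. exact: (is_derive_continuous (is_derive_cosz k)). Qed.

Lemma continuous_sinz k : continuous (sinz k).
Proof. exact: (is_derive_continuous (is_derive_sinz k)). Qed.

Lemma continuousM_fun f F : continuous f -> continuous F ->
  continuous (fun x => f x * F x).
Proof. by move=> cf cF x; apply: continuousM; [exact: cf|exact: cF]. Qed.

Lemma continuousD_fun f F : continuous f -> continuous F ->
  continuous (fun x => f x + F x).
Proof. by move=> cf cF x; apply: continuousD; [exact: cf|exact: cF]. Qed.

Lemma continuousZ_fun a f : continuous f -> continuous (fun x => a * f x).
Proof. by move=> cf; apply: continuousM_fun => // x; exact: cvg_cst. Qed.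

Lemma continuousN_fun f : continuous f -> continuous (fun x => - f x).
Proof. by move=> cf x; apply: (@continuousN _ _ _ f x (cf x)). Qed.

Lemma trig_periodic (t : R -> R) : periodic t (pi *+ 2) ->
  forall k x, t (x + k%:~R * (2 * pi)) = t x.
Proof.
move=> tp; have tp2 y : t (y + 2 * pi) = t y by rewrite mulr_natl tp.
have tn (n : nat) x : t (x + n%:R * (2 * pi)) = t x.
  elim: n x => [|n IH] x; first by rewrite mul0r addr0.
  by rewrite -natr1 mulrDl mul1r addrA tp2 IH.
case=> n x; first exact: tn.
by rewrite NegzE mulrNz mulNr -(tn n.+1) subrK.
Qed.

Lemma cosz_2pi k : cosz k (2 * pi) = 1.
Proof. by rewrite /cosz -[_ * _]add0r (trig_periodic (@cosD2pi R)) cos0. Qed.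

Lemma sinz_2pi k : sinz k (2 * pi) = 0.
Proof. by rewrite /sinz -[_ * _]add0r (trig_periodic (@sinD2pi R)) sin0. Qed.

Lemma circle_int_cosz k : circle_int (cosz k) = if k == 0 then 2 * pi else 0.
Proof.
case: eqP => [->|/eqP k0].
  rewrite (_ : cosz 0 = cst 1); last by apply/funext => x; rewrite /cosz mul0r cos0.
  rewrite /circle_int Rintegral_cst//= lebesgue_measure_itv/= lte_fin.
  by rewrite (mulr_gt0 _ (pi_gt0 _))//= oppr0 addr0 mul1r.
have kR : k%:~R != 0 :> R by rewrite intr_eq0.
have dF (x : R) : is_derive x (1 : R) (k%:~R^-1 \*: sinz k) (cosz k x).
  have := is_derive_sinz k x => d.
  by apply: is_derive_eq; rewrite [LHS]mulrA mulVf// mul1r.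
apply: (circle_int_derive dF); first exact: continuous_cosz.
by rewrite /= sinz_2pi /sinz mulr0 sin0.
Qed.

Lemma circle_int_sinz k : circle_int (sinz k) = 0.
Proof.
have [->|k0] := eqVneq k 0.
  rewrite (_ : sinz 0 = cst 0); last by apply/funext => x; rewrite /sinz mul0r sin0.
  by rewrite /circle_int Rintegral_cst// mul0r.
have kR : k%:~R != 0 :> R by rewrite intr_eq0.
have dF (x : R) : is_derive x (1 : R) (- k%:~R^-1 \*: cosz k) (sinz k x).
  have := is_derive_cosz k x => d.
  by apply: is_derive_eq; rewrite [LHS]mulrNN mulrA mulVf// mul1r.
apply: (circle_int_derive dF); first exact: continuous_sinz.
by rewrite /= cosz_2pi /cosz mulr0 cos0.
Qed.

Lemma coszM k l x : cosz k x * cosz l x = 2^-1 * (cosz (k - l) x + cosz (k + l) x).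
Proof. by rewrite /cosz rmorphB rmorphD/= mulrBl mulrDl cosB cosD; field. Qed.

Lemma sinzM k l x : sinz k x * sinz l x = 2^-1 * (cosz (k - l) x - cosz (k + l) x).
Proof. by rewrite /cosz /sinz rmorphB rmorphD/= mulrBl mulrDl cosB cosD; field. Qed.

Lemma sinz_coszM k l x : sinz k x * cosz l x = 2^-1 * (sinz (k - l) x + sinz (k + l) x).
Proof. by rewrite /cosz /sinz rmorphB rmorphD/= mulrBl mulrDl sinB sinD; field. Qed.

Lemma circle_int_cosz_cosz (m n : nat) :
  circle_int (fun x => cosz m.+1 x * cosz n.+1 x) = if m == n then pi else 0.
Proof.
rewrite (_ : circle_int _ = circle_int (fun x =>
    2^-1 * (cosz (m.+1%:Z - n.+1%:Z) x + cosz (m.+1%:Z + n.+1%:Z) x))); last first.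
  by congr circle_int; apply/funext => x; exact: coszM.
rewrite circle_intZ; last by apply: continuousD_fun; exact: continuous_cosz.
rewrite circle_intD; [|exact: continuous_cosz..].
rewrite !circle_int_cosz subr_eq0 [_ + _ == _]/= addr0.
rewrite (_ : (m.+1%:Z == n.+1%:Z) = (m == n)); last by apply/eqP/eqP; lia.
by case: eqP => _; field.
Qed.

Lemma circle_int_sinz_sinz (m n : nat) :
  circle_int (fun x => sinz m.+1 x * sinz n.+1 x) = if m == n then pi else 0.
Proof.
rewrite (_ : circle_int _ = circle_int (fun x =>
    2^-1 * (cosz (m.+1%:Z - n.+1%:Z) x + (-1) * cosz (m.+1%:Z + n.+1%:Z) x))); last first.
  by congr circle_int; apply/funext => x; rewrite mulN1r; exact: sinzM.
have cc k : continuous (fun x => (-1) * cosz k x).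
  exact/continuousZ_fun/continuous_cosz.
rewrite circle_intZ; last first.
  by apply: continuousD_fun; [exact: continuous_cosz|exact: cc].
rewrite circle_intD; [|exact: continuous_cosz|exact: cc].
rewrite circle_intZ; last exact: continuous_cosz.
rewrite !circle_int_cosz subr_eq0 [_ + _ == _]/= mulr0 addr0.
rewrite (_ : (m.+1%:Z == n.+1%:Z) = (m == n)); last by apply/eqP/eqP; lia.
by case: eqP => _; field.
Qed.

Lemma circle_int_sinz_cosz k l : circle_int (fun x => sinz k x * cosz l x) = 0.
Proof.
rewrite (_ : circle_int _ = circle_int (fun x =>
    2^-1 * (sinz (k - l) x + sinz (k + l) x))); last first.
  by congr circle_int; apply/funext => x; exact: sinz_coszM.
rewrite circle_intZ; last by apply: continuousD_fun; exact: continuous_sinz.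
rewrite circle_intD; [|exact: continuous_sinz..].
by rewrite !circle_int_sinz addr0 mulr0.
Qed.

Definition node (M j : nat) : R := 2 * pi * j%:R / M%:R.

Definition quad (M : nat) f : R := 2 * pi / M%:R * \sum_(j < M) f (node M j).

Lemma quadD M f F : quad M (fun x => f x + F x) = quad M f + quad M F.
Proof. by rewrite /quad -mulrDr -big_split. Qed.

Lemma quadZ M a f : quad M (fun x => a * f x) = a * quad M f.
Proof. by rewrite /quad -mulr_sumr; ring. Qed.

(** With [th = 2 pi k / M], the product of [2 sin (th / 2)] with either sum
    telescopes, the boundary terms cancel by periodicity, and [th / 2] is not a
    multiple of [pi] because 0 < |k| < M. *)
Lemma sum_cos_sin_roots (M : nat) k : k != 0 -> (`|k| < M)%N ->
  \sum_(j < M) cosz k (node M j) = 0 /\ \sum_(j < M) sinz k (node M j) = 0.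
Proof.
move=> k0 kM; have M0 : M%:R != 0 :> R by rewrite pnatr_eq0; lia.
pose th : R := k%:~R * (2 * pi) / M%:R.
have nodeE (j : nat) : k%:~R * node M j = j%:R * th.
  by rewrite /node /th; field.
have sth : 2 * sin (th / 2) != 0.
  rewrite mulf_neq0//.
  have pos (p : nat) : (0 < p < M)%N -> 0 < sin (p%:R * pi / M%:R : R).
    move=> /andP[p0 pM]; have M1 : 0 < M%:R :> R by rewrite ltr0n; lia.
    rewrite sin_gt0_pi// divr_gt0 ?mulr_gt0 ?pi_gt0 ?ltr0n//=; last by lia.
    by rewrite ltr_pdivrMr// mulrC ltr_pM2l ?pi_gt0// ltr_nat.
  rewrite (_ : th / 2 = k%:~R * pi / M%:R); last by rewrite /th; field.
  case: k k0 kM {th nodeE} => n k0 kM; first by rewrite gt_eqF// pos//; lia.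
  rewrite NegzE mulrNz !mulNr sinN oppr_eq0 gt_eqF// pos//; lia.
have thM (t : R -> R) : periodic t (pi *+ 2) -> t (M%:R * th - th / 2) = t (- (th / 2)).
  move=> tp; rewrite -(trig_periodic tp k (- (th / 2))) addrC; congr (t (_ + _)).
  by rewrite /th; field.
have half (j : nat) : j.+1%:R * th - th / 2 = j%:R * th + th / 2.
  by rewrite -natr1; field.
split; apply: (mulfI sth); rewrite mulr0 mulr_sumr.
  pose a (j : nat) := sin (j%:R * th - th / 2).
  rewrite (eq_bigr (fun j : 'I_M => a j.+1 - a j)).
    rewrite -(big_mkord xpredT (fun j => a j.+1 - a j)) telescope_sumr//.
    by rewrite /a thM ?mul0r ?add0r ?subrr//; exact: sinD2pi.
  by move=> j _; rewrite /a half /cosz nodeE sinB sinD; ring.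
pose a (j : nat) := - cos (j%:R * th - th / 2).
rewrite (eq_bigr (fun j : 'I_M => a j.+1 - a j)).
  rewrite -(big_mkord xpredT (fun j => a j.+1 - a j)) telescope_sumr//.
  by rewrite /a thM ?mul0r ?add0r ?subrr//; exact: cosD2pi.
by move=> j _; rewrite /a half /sinz nodeE cosB cosD; ring.
Qed.

(** Stands for: [f] is a trigonometric polynomial of degree at most [d], as far as
    the rule with [M] nodes can tell. Testing against all frequencies [k] with
    |k| + d < M makes the property stable under multiplication by cosines and
    sines, each of which raises [d] by its frequency. *)
Definition exact_quad (M d : nat) f := continuous f /\
  forall k, (`|k| + d < M)%N ->
    circle_int (fun x => f x * cosz k x) = quad M (fun x => f x * cosz k x) /\
    circle_int (fun x => f x * sinz k x) = quad M (fun x => f x * sinz k x).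

Lemma exact_quad1 M : exact_quad M 0 (cst 1).
Proof.
split; first by move=> x; exact: cvg_cst.
move=> k; rewrite addn0 => kM.
have M0 : M%:R != 0 :> R by rewrite pnatr_eq0; lia.
have q1 (t : R -> R) : (fun x => cst 1 x * t x) = t by apply/funext => x; rewrite /= mul1r.
rewrite !q1 circle_int_cosz circle_int_sinz /quad; case: eqP => [->|/eqP k0].
  split; last by rewrite big1 ?mulr0// => j _; rewrite /sinz mul0r sin0.
  rewrite (eq_bigr (fun=> 1)); last by move=> j _; rewrite /cosz mul0r cos0.
  by rewrite sumr_const card_ord; field.
by have [-> ->] := sum_cos_sin_roots k0 kM; rewrite mulr0.
Qed.

Lemma exact_quad_leq M d d' f : (d <= d')%N -> exact_quad M d f -> exact_quad M d' f.
Proof. by move=> dd [cf ef]; split => // k kM; apply: ef; lia. Qed.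

Lemma exact_quadD M d f F : exact_quad M d f -> exact_quad M d F ->
  exact_quad M d (fun x => f x + F x).
Proof.
move=> [cf ef] [cF eF]; split; first exact: continuousD_fun.
move=> k kM; have [f1 f2] := ef k kM; have [F1 F2] := eF k kM.
have e (t : R -> R) : (fun x => (f x + F x) * t x) = (fun x => f x * t x + F x * t x).
  by apply/funext => x; rewrite mulrDl.
rewrite !e !quadD !circle_intD; try (apply: continuousM_fun => //).
  by rewrite f1 f2 F1 F2.
1,2: exact: continuous_sinz.
1,2: exact: continuous_cosz.
Qed.

Lemma exact_quadZ M d a f : exact_quad M d f -> exact_quad M d (fun x => a * f x).
Proof.
move=> [cf ef]; split; first exact: continuousZ_fun.
move=> k kM; have [f1 f2] := ef k kM.
have e (t : R -> R) : (fun x => (a * f x) * t x) = (fun x => a * (f x * t x)).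
  by apply/funext => x; rewrite mulrA.
rewrite !e !quadZ !circle_intZ ?f1 ?f2//; apply: continuousM_fun => //.
  exact: continuous_sinz.
exact: continuous_cosz.
Qed.

Lemma exact_quad_sum M d (J : Type) (s : seq J) (h : J -> R -> R) :
  (forall j, exact_quad M d (h j)) -> exact_quad M d (fun x => \sum_(j <- s) h j x).
Proof.
move=> eh; elim: s => [|j s IH].
  rewrite (_ : (fun x => _) = (fun x => 0 * cst 1 x)); last first.
    by apply/funext => x; rewrite big_nil mul0r.
  by apply/exact_quadZ/(exact_quad_leq (leq0n d))/exact_quad1.
rewrite (_ : (fun x => _) = (fun x => h j x + \sum_(i <- s) h i x)).
  exact: exact_quadD.
by apply/funext => x; rewrite big_cons.
Qed.

Lemma exact_quad_cosz M d f l : exact_quad M d f ->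
  exact_quad M (d + `|l|) (fun x => f x * cosz l x).
Proof.
move=> [cf ef]; split; first by apply: continuousM_fun => //; exact: continuous_cosz.
move=> k kM.
have [a1 a2] := ef (k - l) ltac:(lia); have [b1 b2] := ef (k + l) ltac:(lia).
have e1 : (fun x => f x * cosz l x * cosz k x) =
    (fun x => 2^-1 * (f x * cosz (k - l) x + f x * cosz (k + l) x)).
  by apply/funext => x; rewrite -mulrA (mulrC (cosz l x)) coszM; ring.
have e2 : (fun x => f x * cosz l x * sinz k x) =
    (fun x => 2^-1 * (f x * sinz (k - l) x + f x * sinz (k + l) x)).
  by apply/funext => x; rewrite -mulrA (mulrC (cosz l x)) sinz_coszM; ring.
have cc := fun j => continuousM_fun cf (@continuous_cosz j).
have cs := fun j => continuousM_fun cf (@continuous_sinz j).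
rewrite e1 e2 !quadZ !quadD !circle_intZ ?circle_intD ?a1 ?a2 ?b1 ?b2//;
  exact: continuousD_fun.
Qed.

Lemma exact_quad_sinz M d f l : exact_quad M d f ->
  exact_quad M (d + `|l|) (fun x => f x * sinz l x).
Proof.
move=> [cf ef]; split; first by apply: continuousM_fun => //; exact: continuous_sinz.
move=> k kM.
have [a1 a2] := ef (l - k) ltac:(lia); have [b1 b2] := ef (l + k) ltac:(lia).
have e1 : (fun x => f x * sinz l x * sinz k x) =
    (fun x => 2^-1 * (f x * cosz (l - k) x + (- 1) * (f x * cosz (l + k) x))).
  by apply/funext => x; rewrite -mulrA sinzM; ring.
have e2 : (fun x => f x * sinz l x * cosz k x) =
    (fun x => 2^-1 * (f x * sinz (l - k) x + f x * sinz (l + k) x)).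
  by apply/funext => x; rewrite -mulrA sinz_coszM; ring.
have cc := fun j => continuousM_fun cf (@continuous_cosz j).
have cs := fun j => continuousM_fun cf (@continuous_sinz j).
have ccN := fun j => @continuousZ_fun (- 1) _ (cc j).
rewrite e1 e2 !quadZ !quadD !quadZ !circle_intZ ?circle_intD ?circle_intZ ?a1 ?a2 ?b1 ?b2//;
  exact: continuousD_fun.
Qed.

End circle_int_theory.

(** * Trigonometric polynomials and their coordinates *)
Section trigpoly_theory.
Context {R : realType} {N : nat}.
Local Notation E := (E_ R N).
Implicit Types (c d : E) (f : R -> R) (k : 'I_N).

Definition of_coefs (p q : 'I_N -> R) : E := row_mx (\row_k p k) (\row_k q k).

Lemma acoef_of_coefs p q k : acoef (of_coefs p q) k = p k.
Proof. by rewrite /acoef /of_coefs row_mxEl mxE. Qed.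

Lemma bcoef_of_coefs p q k : bcoef (of_coefs p q) k = q k.
Proof. by rewrite /bcoef /of_coefs row_mxEr mxE. Qed.

Lemma coefP c d : (forall k, acoef c k = acoef d k) ->
  (forall k, bcoef c k = bcoef d k) -> c = d.
Proof.
move=> ha hb; apply/rowP => i.
by rewrite -(splitK i); case: (fintype.split i) => j /=; [exact: ha|exact: hb].
Qed.

Lemma acoefD c d k : acoef (c + d) k = acoef c k + acoef d k.
Proof. by rewrite /acoef mxE. Qed.

Lemma bcoefD c d k : bcoef (c + d) k = bcoef c k + bcoef d k.
Proof. by rewrite /bcoef mxE. Qed.

Lemma dotrV_coef c d : dotrV c d =
  \sum_k (acoef c k * acoef d k + bcoef c k * bcoef d k).
Proof. by rewrite /dotrV big_split_ord /= -big_split. Qed.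

Lemma trigpolyE c x : trigpoly c x =
  \sum_k (acoef c k * cosz k.+1 x + bcoef c k * sinz k.+1 x).
Proof. by []. Qed.

Lemma trigpoly_dotrV c x :
  trigpoly c x = dotrV c (of_coefs (fun k => cosz k.+1 x) (fun k => sinz k.+1 x)).
Proof.
by rewrite dotrV_coef; apply: eq_bigr => k _; rewrite acoef_of_coefs bcoef_of_coefs.
Qed.

Lemma trigpolyD c d x : trigpoly (c + d) x = trigpoly c x + trigpoly d x.
Proof. by rewrite !trigpoly_dotrV dotrVDl. Qed.

Lemma continuous_trigpoly c : continuous (trigpoly c).
Proof.
apply: continuous_sum => k; apply: continuousD_fun; apply: continuousZ_fun.
  exact: (@continuous_cosz _ k.+1).
exact: (@continuous_sinz _ k.+1).
Qed.

Lemma circle_int_trigpoly f c : continuous f ->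
  circle_int (fun x => f x * trigpoly c x) =
  \sum_k (acoef c k * circle_int (fun x => f x * cosz k.+1 x) +
          bcoef c k * circle_int (fun x => f x * sinz k.+1 x)).
Proof.
move=> cf.
have cc k := continuousM_fun cf (@continuous_cosz R k.+1).
have cs k := continuousM_fun cf (@continuous_sinz R k.+1).
have ca k := @continuousZ_fun _ (acoef c k) _ (cc k).
have cb k := @continuousZ_fun _ (bcoef c k) _ (cs k).
under eq_bigr do rewrite -!circle_intZ// -circle_intD//.
rewrite -circle_int_sum; last by move=> k; exact: continuousD_fun.
congr circle_int; apply/funext => x; rewrite trigpolyE mulr_sumr.
by apply: eq_bigr => k _; ring.
Qed.

Lemma exact_quad_trigpoly M n f c : exact_quad M n f ->
  exact_quad M (n + N) (fun x => f x * trigpoly c x).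
Proof.
move=> ef.
rewrite (_ : (fun x => _) = (fun x => \sum_k (acoef c k * (f x * cosz k.+1 x) +
    bcoef c k * (f x * sinz k.+1 x)))); last first.
  by apply/funext => x; rewrite trigpolyE mulr_sumr; apply: eq_bigr => k _; ring.
apply: exact_quad_sum => k; apply: exact_quadD; apply: exact_quadZ.
  by apply: (exact_quad_leq _ (exact_quad_cosz k.+1 ef)); rewrite leq_add2l; exact: ltn_ord.
by apply: (exact_quad_leq _ (exact_quad_sinz k.+1 ef)); rewrite leq_add2l; exact: ltn_ord.
Qed.

(** [insub m] is the index of the frequency [m.+1], or [None] when this frequency
    exceeds [N]; high frequencies are needed for the partial sums of the Hilbert
    transform. *)
Lemma circle_int_trigpoly_cosz c (m : nat) :
  circle_int (fun x => trigpoly c x * cosz m.+1 x) =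
  if insub m is Some k then pi * acoef c k else 0.
Proof.
rewrite (_ : (fun x => _) = (fun x => cosz m.+1 x * trigpoly c x)); last first.
  by apply/funext => x; rewrite mulrC.
rewrite circle_int_trigpoly; last exact: continuous_cosz.
have cs0 k : circle_int (fun x => cosz m.+1 x * sinz k.+1 x) = 0 :> R.
  rewrite -[RHS](@circle_int_sinz_cosz R k.+1 m.+1).
  by congr circle_int; apply/funext => x; rewrite mulrC.
under eq_bigr do rewrite cs0 mulr0 addr0 circle_int_cosz_cosz.
case: insubP => [k _ /= km|mN].
  rewrite (bigD1 k)//= km eqxx big1 ?addr0 1?mulrC// => j jk.
  by rewrite -km ifN ?mulr0// eq_sym.
rewrite big1// => k _; rewrite ifN ?mulr0//.
by apply: contraNneq mN => ->.
Qed.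

Lemma circle_int_trigpoly_sinz c (m : nat) :
  circle_int (fun x => trigpoly c x * sinz m.+1 x) =
  if insub m is Some k then pi * bcoef c k else 0.
Proof.
rewrite (_ : (fun x => _) = (fun x => sinz m.+1 x * trigpoly c x)); last first.
  by apply/funext => x; rewrite mulrC.
rewrite circle_int_trigpoly; last exact: continuous_sinz.
under eq_bigr do rewrite circle_int_sinz_cosz mulr0 add0r circle_int_sinz_sinz.
case: insubP => [k _ /= km|mN].
  rewrite (bigD1 k)//= km eqxx big1 ?addr0 1?mulrC// => j jk.
  by rewrite -km ifN ?mulr0// eq_sym.
rewrite big1// => k _; rewrite ifN ?mulr0//.
by apply: contraNneq mN => ->.
Qed.

Lemma trigpoly_inj c : (forall x, trigpoly c x = 0) -> c = 0.
Proof.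
move=> c0.
have z (t : R -> R) : circle_int (fun x => trigpoly c x * t x) = 0.
  rewrite (_ : (fun x => _) = (fun x => 0 * cst 0 x)).
    by rewrite circle_intZ ?mul0r// => x; exact: cvg_cst.
  by apply/funext => x; rewrite c0 !mul0r.
have p0 : pi != 0 :> R by rewrite gt_eqF// pi_gt0.
apply: coefP => k.
  have := circle_int_trigpoly_cosz c k; rewrite z valK => /esym/eqP.
  by rewrite mulf_eq0 (negbTE p0)/= => /eqP ->; rewrite /acoef mxE.
have := circle_int_trigpoly_sinz c k; rewrite z valK => /esym/eqP.
by rewrite mulf_eq0 (negbTE p0)/= => /eqP ->; rewrite /bcoef mxE.
Qed.

Lemma L2norm_trigpoly c : L2norm (trigpoly c) ^+ 2 = pi * dotrV c c.
Proof.
have e : circle_int (fun x => trigpoly c x ^+ 2) = pi * dotrV c c.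
  rewrite (_ : (fun x => _) = (fun x => trigpoly c x * trigpoly c x)); last first.
    by apply/funext => x; rewrite expr2.
  rewrite circle_int_trigpoly; last exact: continuous_trigpoly.
  rewrite dotrV_coef mulr_sumr; apply: eq_bigr => k _.
  by rewrite circle_int_trigpoly_cosz circle_int_trigpoly_sinz valK; ring.
rewrite /L2norm sqr_sqrtr e// mulr_ge0 ?pi_ge0//.
exact: dotrV_ge0.
Qed.

Definition dtrig c : E :=
  of_coefs (fun k => k.+1%:R * bcoef c k) (fun k => - (k.+1%:R * acoef c k)).

Lemma is_derive_sumf (n : nat) (h : 'I_n -> R -> R) (dh : 'I_n -> R) (x : R) :
  (forall i, is_derive x (1 : R) (h i) (dh i)) ->
  is_derive x (1 : R) (fun y => \sum_i h i y) (\sum_i dh i).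
Proof.
move=> dhi; rewrite (_ : (fun y => _) = \sum_i h i); first exact: is_derive_sum.
by apply/funext => y; rewrite fct_sumE.
Qed.

Lemma is_deriveZf (a : R) f (df x : R) : is_derive x (1 : R) f df ->
  is_derive x (1 : R) (fun y => a * f y) (a * df).
Proof.
move=> d; rewrite (_ : (fun y => _) = a \*: f); last by apply/funext.
exact: is_deriveZ.
Qed.

Lemma is_derive_trigpoly c x : is_derive x (1 : R) (trigpoly c) (trigpoly (dtrig c) x).
Proof.
rewrite (trigpolyE (dtrig c)).
apply: is_derive_sumf => k.
have d1 := is_deriveZf (acoef c k) (is_derive_cosz k.+1 x).
have d2 := is_deriveZf (bcoef c k) (is_derive_sinz k.+1 x).
have d := is_deriveD d1 d2.
rewrite (_ : _ + _ = acoef c k * - (k.+1%:~R * sinz k.+1 x) +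
   bcoef c k * (k.+1%:~R * cosz k.+1 x)); first exact: d.
by rewrite acoef_of_coefs bcoef_of_coefs; rewrite -!pmulrn; ring.
Qed.

Lemma derive1_trigpoly c : derive1 (trigpoly c) = trigpoly (dtrig c).
Proof.
apply/funext => x; rewrite derive1E; apply: derive_val.
exact: is_derive_trigpoly.
Qed.

Lemma trigpoly_periodic c : trigpoly c (2 * pi) = trigpoly c 0.
Proof.
rewrite !trigpolyE; apply: eq_bigr => k _.
by rewrite cosz_2pi sinz_2pi /cosz /sinz !mulr0 cos0 sin0 mulr0.
Qed.

End trigpoly_theory.

(** * Fourier multipliers and the equation in coordinates *)
Section fourier_theory.
Context {R : realType}.
Implicit Types (w f : R -> R) (n : int) (M : nat).

Definition ccoef w n : R := circle_int (fun x => w x * cosz n x).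
Definition scoef w n : R := circle_int (fun x => w x * sinz n x).

Lemma fourierE w n : continuous w ->
  fourier w n = ((ccoef w n / (2 * pi)) +i* (- (scoef w n / (2 * pi))))%C.
Proof.
move=> cw; rewrite /fourier /circle_cint.
rewrite (_ : circle_int (fun x => complex.Re _) = ccoef w n); last first.
  by congr circle_int; apply/funext => x; rewrite /= cosN mul0r subr0.
rewrite (_ : circle_int (fun x => complex.Im _) = - scoef w n); last first.
  rewrite -mulN1r -circle_intZ; last first.
    by apply: continuousM_fun => //; exact: continuous_sinz.
  by congr circle_int; apply/funext => x; rewrite /= sinN mul0r addr0 /sinz; ring.
by apply/eqP; rewrite eq_complex /=; apply/andP; split; apply/eqP; ring.
Qed.

Lemma sum_symmetric (F : int -> R) M :
  \sum_(k < (2 * M).+1) F (k%:Z - M%:Z) =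
  F 0 + \sum_(k < M) (F k.+1%:Z + F (- k.+1%:Z)).
Proof.
elim: M => [|M IH]; first by rewrite big_ord0 addr0 big_ord1.
rewrite (_ : (2 * M.+1).+1 = (2 * M).+3)%N; last by lia.
rewrite big_ord_recr big_ord_recl [in RHS]big_ord_recr /=.
rewrite (eq_bigr (fun k : 'I_(2 * M).+1 => F (k%:Z - M%:Z))); last first.
  by move=> k _; congr F; rewrite /= /bump /=; lia.
rewrite IH sub0r (_ : (2 * M).+2%:Z - M.+1%:Z = M.+1%:Z); last by lia.
by ring.
Qed.

Lemma ccoefN w n : ccoef w (- n) = ccoef w n.
Proof.
by congr circle_int; apply/funext => x; rewrite /cosz mulrNz mulNr cosN.
Qed.

Lemma scoefN w n : continuous w -> scoef w (- n) = - scoef w n.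
Proof.
move=> cw; rewrite -[RHS]mulN1r -circle_intZ; last first.
  by apply: continuousM_fun => //; exact: continuous_sinz.
by congr circle_int; apply/funext => x; rewrite /sinz mulrNz mulNr sinN; ring.
Qed.

Lemma S_E M w x : continuous w -> S_ M w x =
  ccoef w 0 / (2 * pi) +
  \sum_(k < M) (ccoef w k.+1 / pi * cosz k.+1 x + scoef w k.+1 / pi * sinz k.+1 x).
Proof.
have p0 : pi != 0 :> R by rewrite gt_eqF// pi_gt0.
move=> cw; rewrite /S_ /fourier_sum raddf_sum.
pose F n : R := (ccoef w n * cosz n x + scoef w n * sinz n x) / (2 * pi).
rewrite (eq_bigr (fun k : 'I_(2 * M).+1 => F (k%:Z - M%:Z))); last first.
  move=> k _; rewrite fourierE// /F /cosz /sinz /= ; ring.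
rewrite sum_symmetric; congr (_ + _).
  by rewrite /F /cosz /sinz !mul0r cos0 sin0; ring.
apply: eq_bigr => k _; rewrite /F ccoefN scoefN// /cosz /sinz !mulrNz !mulNr cosN sinN.
(* [field] unfolds the definition of [pi], so [pi] is generalized first *)
by move: (pi : R) p0 => p p0; field.
Qed.

Lemma hilbert_sumE M w x : continuous w ->
  fourier_sum (fun n => - 'i%C * (sgz n)%:~R) M w x =
  \sum_(k < M) (ccoef w k.+1 / pi * sinz k.+1 x - scoef w k.+1 / pi * cosz k.+1 x).
Proof.
have p0 : pi != 0 :> R by rewrite gt_eqF// pi_gt0.
move=> cw; rewrite /fourier_sum raddf_sum.
pose F n : R := (sgz n)%:~R *
  (ccoef w n * sinz n x - scoef w n * cosz n x) / (2 * pi).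
rewrite (eq_bigr (fun k : 'I_(2 * M).+1 => F (k%:Z - M%:Z))); last first.
  move=> k _; set n := _ - _.
  have -> : ((sgz n)%:~R : R[i]) = ((sgz n)%:~R)%:C%C.
    by rewrite -(rmorph_int (@real_complex R)).
  by rewrite fourierE// /F /cosz /sinz /=; ring.
rewrite sum_symmetric (_ : F 0 = 0) ?add0r; last by rewrite /F sgz0 !mul0r.
apply: eq_bigr => k _; rewrite /F ccoefN scoefN// /cosz /sinz !mulrNz !mulNr cosN sinN.
rewrite (_ : sgz _ = 1)//.
by move: (pi : R) p0 => p p0; field.
Qed.

(** The symmetric partial sums are constant from rank [N] on. *)
Lemma hilbert_trigpoly N (c : E_ R N) x :
  hilbert (trigpoly c) x = trigpoly (of_coefs (fun k => - bcoef c k) (acoef c)) x.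
Proof.
rewrite /hilbert; apply/cvg_lim => //; apply: cvg_near_cst.
near=> M.
have NM : (N <= M)%N by near: M; exact: nbhs_infty_ge.
rewrite hilbert_sumE; last exact: continuous_trigpoly.
rewrite trigpolyE /ccoef /scoef.
have p0 : pi != 0 :> R by rewrite gt_eqF// pi_gt0.
pose G (k : nat) : R := if insub k is Some j then
  acoef c j * sinz k.+1 x - bcoef c j * cosz k.+1 x else 0.
rewrite (eq_bigr (fun k : 'I_M => G k)); last first.
  move=> k _; rewrite circle_int_trigpoly_cosz circle_int_trigpoly_sinz /G.
  by case: insub => [j|]; [move: (pi : R) p0 => p p0; field|rewrite !mul0r subrr].
have tail : \sum_(N <= k < M) G k = 0.
  rewrite big_nat_cond big1// => k; rewrite andbT => /andP[Nk _].
  by rewrite /G insubF// ltnNge Nk.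
rewrite -(big_mkord xpredT G) (big_cat_nat (n := N))//= tail addr0 big_mkord.
by apply: eq_bigr => k _; rewrite /G valK acoef_of_coefs bcoef_of_coefs; ring.
Unshelve. all: by end_near. Qed.

End fourier_theory.

Section bo_field.
Context {R : realType} {N : nat}.
Local Notation E := (E_ R N).
Implicit Types (c : E) (k : 'I_N).

Definition sqcos c k : R := circle_int (fun x => trigpoly c x ^+ 2 * cosz k.+1 x).
Definition sqsin c k : R := circle_int (fun x => trigpoly c x ^+ 2 * sinz k.+1 x).

(** The term [k.+1%:R ^+ 2] is the symbol of the dispersion H d_x^2; the other one
    comes from S_N d_x (u^2) after an integration by parts. *)
Definition bo_field c : E := of_coefs
  (fun k => - k.+1%:R ^+ 2 * bcoef c k - k.+1%:R / pi * sqsin c k)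
  (fun k => k.+1%:R ^+ 2 * acoef c k + k.+1%:R / pi * sqcos c k).

Definition sq_deriv c (x : R) : R := 2 * (trigpoly c x * trigpoly (dtrig c) x).

Lemma is_deriveM_fun (f g : R -> R) (x df dg : R) :
  is_derive x (1 : R) f df -> is_derive x (1 : R) g dg ->
  is_derive x (1 : R) (fun y => f y * g y) (df * g x + f x * dg).
Proof.
move=> d1 d2; have d := is_deriveM d1 d2.
rewrite (_ : _ + _ = f x *: dg + g x *: df); first exact: d.
by rewrite addrC [g x *: _]mulrC.
Qed.

Lemma is_derive_trigpoly_sq c x :
  is_derive x (1 : R) (fun y => trigpoly c y ^+ 2) (sq_deriv c x).
Proof.
have d := is_deriveM_fun (is_derive_trigpoly c x) (is_derive_trigpoly c x).
rewrite (_ : (fun y => _) = (fun y => trigpoly c y * trigpoly c y)); last first.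
  by apply/funext => y; rewrite expr2.
by rewrite (_ : sq_deriv c x = trigpoly (dtrig c) x * trigpoly c x + trigpoly c x * trigpoly (dtrig c) x)//
  /sq_deriv; ring.
Qed.

Lemma continuous_sq_deriv c : continuous (sq_deriv c).
Proof.
apply: continuousZ_fun; apply: continuousM_fun; exact: continuous_trigpoly.
Qed.

Lemma continuous_trigpoly_sq c : continuous (fun x => trigpoly c x ^+ 2).
Proof. exact: (is_derive_continuous (is_derive_trigpoly_sq c)). Qed.

Lemma circle_int_parts (f g df dg : R -> R) :
  (forall x, is_derive x (1 : R) f (df x)) -> (forall x, is_derive x (1 : R) g (dg x)) ->
  continuous df -> continuous dg -> f (2 * pi) = f 0 -> g (2 * pi) = g 0 ->
  circle_int (fun x => df x * g x) = - circle_int (fun x => f x * dg x).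
Proof.
move=> fd gd cdf cdg f0 g0.
have cf := is_derive_continuous fd; have cg := is_derive_continuous gd.
apply/eqP; rewrite -addr_eq0; apply/eqP.
rewrite -circle_intD; [|exact: continuousM_fun..].
apply: (@circle_int_derive _ (fun x => f x * g x)).
- by move=> x; exact: is_deriveM_fun.
- by apply: continuousD_fun; exact: continuousM_fun.
- by rewrite f0 g0.
Qed.

Lemma trigpoly_sq_periodic c : trigpoly c (2 * pi) ^+ 2 = trigpoly c 0 ^+ 2.
Proof. by rewrite trigpoly_periodic. Qed.

Lemma ccoef_sq_deriv c k : ccoef (sq_deriv c) k.+1 = k.+1%:R * sqsin c k.
Proof.
rewrite /ccoef (circle_int_parts (is_derive_trigpoly_sq c) (is_derive_cosz k.+1)).
- rewrite -mulN1r -!circle_intZ.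
  + by congr circle_int; apply/funext => x; rewrite -pmulrn; ring.
  + apply: continuousM_fun; first exact: continuous_trigpoly_sq.
    exact: continuous_sinz.
  + apply: continuousM_fun; first exact: continuous_trigpoly_sq.
    by apply/continuousN_fun/continuousZ_fun/continuous_sinz.
- exact: continuous_sq_deriv.
- by apply/continuousN_fun/continuousZ_fun/continuous_sinz.
- exact: trigpoly_sq_periodic.
- by rewrite cosz_2pi /cosz mulr0 cos0.
Qed.

Lemma scoef_sq_deriv c k : scoef (sq_deriv c) k.+1 = - (k.+1%:R * sqcos c k).
Proof.
rewrite /scoef (circle_int_parts (is_derive_trigpoly_sq c) (is_derive_sinz k.+1)).
- rewrite -circle_intZ.
  + by congr (- circle_int _); apply/funext => x; rewrite -pmulrn; ring.
  + apply: continuousM_fun; first exact: continuous_trigpoly_sq.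
    exact: continuous_cosz.
- exact: continuous_sq_deriv.
- exact/continuousZ_fun/continuous_cosz.
- exact: trigpoly_sq_periodic.
- by rewrite sinz_2pi /sinz mulr0 sin0.
Qed.

Lemma ccoef_sq_deriv0 c : ccoef (sq_deriv c) 0 = 0.
Proof.
rewrite /ccoef (_ : (fun x => _) = sq_deriv c); last first.
  by apply/funext => x; rewrite /cosz mul0r cos0 mulr1.
apply: (circle_int_derive (is_derive_trigpoly_sq c)); first exact: continuous_sq_deriv.
exact: trigpoly_sq_periodic.
Qed.

(** Every term of the equation is a trigonometric polynomial of degree at most
    [N] without constant term, so the equation is an identity between
    coordinates. *)
Lemma is_bo_solution_solves (u : R -> E) : is_bo_solution u -> solves bo_field u.
Proof.
move=> bo t; have [du eq_t] := bo t.
apply: DeriveDef => //; rewrite -derive1E.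
set d := derive1 u t in eq_t *; set c := u t in eq_t *.
pose h : E := of_coefs (fun k => - bcoef (dtrig (dtrig c)) k) (acoef (dtrig (dtrig c))).
pose p : E := of_coefs (fun k => k.+1%:R / pi * sqsin c k) (fun k => - (k.+1%:R / pi * sqcos c k)).
have dhp : d + h + p = 0.
  apply: trigpoly_inj => x; rewrite !trigpolyD -[RHS](eq_t x); congr (_ + _ + _).
    by rewrite -hilbert_trigpoly /= !derive1_trigpoly.
  rewrite (_ : derive1 _ = sq_deriv c); last first.
    apply/funext => y; rewrite derive1E; apply: derive_val.
    exact: is_derive_trigpoly_sq.
  rewrite S_E; last exact: continuous_sq_deriv.
  rewrite ccoef_sq_deriv0 mul0r add0r trigpolyE; apply: eq_bigr => k _.
  by rewrite ccoef_sq_deriv scoef_sq_deriv acoef_of_coefs bcoef_of_coefs; ring.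
apply: coefP => k.
  have := congr1 (fun z => acoef z k) dhp; rewrite /= !acoefD !acoef_of_coefs bcoef_of_coefs.
  rewrite [acoef 0 k]mxE acoef_of_coefs => /eqP; rewrite -addrA addr_eq0 => /eqP ->; ring.
have := congr1 (fun z => bcoef z k) dhp; rewrite /= !bcoefD !bcoef_of_coefs acoef_of_coefs.
rewrite [bcoef 0 k]mxE bcoef_of_coefs => /eqP; rewrite -addrA addr_eq0 => /eqP ->; ring.
Qed.

End bo_field.

(** * Integration against a measure with density *)
Section density.
Context d (T : measurableType d) (R : realType).
Variables (mu nu : {measure set T -> \bar R}) (rho : T -> R).
Hypothesis mrho : measurable_fun setT rho.
Hypothesis rho0 : forall x, 0 <= rho x.
Hypothesis nuE : forall A, measurable A -> nu A = (\int[mu]_(x in A) (rho x)%:E)%E.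

Import HBNNSimple.

(** Monotone convergence reduces to simple functions, and linearity to indicators,
    for which the identity is the definition of the density. *)
Lemma ge0_integral_density (D : set T) (f : T -> \bar R) :
  measurable D -> measurable_fun D f -> (forall x, (0 <= f x)%E) ->
  (\int[nu]_(x in D) f x = \int[mu]_(x in D) (f x * (rho x)%:E))%E.
Proof.
move=> mD mf f0; pose h := nnsfun_approx mD mf.
have mrhoD : measurable_fun D (fun x => (rho x)%:E).
  by apply/measurable_EFinP; exact: measurable_funTS.
have hf x : D x -> (h n x)%:E @[n --> \oo] --> f x.
  by move=> Dx; apply: cvg_nnsfun_approx.
have mh n : measurable_fun D (EFin \o h n).
  by apply/measurable_EFinP; exact: measurable_funTS.
transitivity (limn (fun n => \int[nu]_(x in D) (h n x)%:E))%E.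
  rewrite -monotone_convergence//.
  - by apply: eq_integral => x /[!inE] Dx; apply/esym/cvg_lim => //; exact: hf.
  - by move=> n x _; rewrite lee_fin.
  - by move=> x _ m n mn; rewrite lee_fin; exact/lefP/nd_nnsfun_approx.
transitivity (limn (fun n => \int[mu]_(x in D) ((h n x)%:E * (rho x)%:E)))%E; last first.
  rewrite -monotone_convergence//.
  - apply: eq_integral => x /[!inE] Dx; apply/cvg_lim => //.
    by apply: cvgeZr => //; exact: hf.
  - by move=> n; exact: (emeasurable_funM (mh n) mrhoD).
  - by move=> n x _; rewrite mule_ge0 ?lee_fin.
  - move=> x _ m n mn; rewrite lee_wpmul2r ?lee_fin//.
    exact/lefP/nd_nnsfun_approx.
congr (limn _); apply/funext => n.
have mind r : measurable_fun D (fun x => (r * \1_(h n @^-1` [set r]) x)%:E).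
  by apply/measurable_EFinP; apply: measurable_funTS; exact: measurable_funM.
transitivity (\int[nu]_(x in D)
   (\sum_(y \in range (h n)) (y * \1_(h n @^-1` [set y]) x)%:E))%E.
  by apply: eq_integral => x _; rewrite /= {1}fimfunE -fsumEFin.
rewrite ge0_integral_fsum//; last by move=> y x _; exact: nnfun_muleindic_ge0.
transitivity (\int[mu]_(x in D) (\sum_(y \in range (h n))
    (y * \1_(h n @^-1` [set y]) x)%:E * (rho x)%:E))%E; last first.
  apply: eq_integral => x _.
  rewrite -ge0_mule_fsuml => [|y]; last exact: nnfun_muleindic_ge0.
  by rewrite fsumEFin// -(fimfunE _ x).
rewrite ge0_integral_fsum//; last 2 first.
- by move=> y; exact: (emeasurable_funM (mind y) mrhoD).
- by move=> y x _; apply: mule_ge0; [exact: nnfun_muleindic_ge0|rewrite lee_fin].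
apply: eq_fsbigr => y /[!inE] -[x0 _ yE].
have y0 : 0 <= y by rewrite -yE.
under eq_integral do rewrite EFinM.
under [RHS]eq_integral do rewrite EFinM -muleA.
have my : measurable (h n @^-1` [set y]) by [].
have mi : measurable_fun D (fun x => (\1_(h n @^-1` [set y]) x)%:E : \bar R).
  by apply/measurable_EFinP; exact: measurable_funTS.
rewrite !ge0_integralZl//; last 2 first.
- exact: (emeasurable_funM mi mrhoD).
- by move=> x _; rewrite mule_ge0 ?lee_fin.
congr (_ * _)%E.
rewrite integral_indic// nuE; last exact: measurableI.
rewrite setIC integral_mkcondr; apply: eq_integral => x _.
by rewrite epatch_indic /= muleC.
Qed.

End density.

(** * Conservation laws *)
Section conservation.
Context {R : realType} {N : nat}.
Local Notation E := (E_ R N).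
Implicit Types (c d : E) (k : 'I_N) (u : R -> E).

Let p0 : pi != 0 :> R. Proof. by rewrite gt_eqF// pi_gt0. Qed.

Lemma circle_int_sq_trigpoly c d :
  circle_int (fun x => trigpoly c x ^+ 2 * trigpoly d x) =
  \sum_k (acoef d k * sqcos c k + bcoef d k * sqsin c k).
Proof. by rewrite circle_int_trigpoly//; exact: continuous_trigpoly_sq. Qed.

(** The integrand is the derivative of u^3 / 3. *)
Lemma circle_int_sq_dtrig c :
  circle_int (fun x => trigpoly c x ^+ 2 * trigpoly (dtrig c) x) = 0.
Proof.
have d x : is_derive x (1 : R) (fun y => 3^-1 * (trigpoly c y * trigpoly c y ^+ 2))
    (trigpoly c x ^+ 2 * trigpoly (dtrig c) x).
  have := is_deriveZf (3^-1)
    (is_deriveM_fun (is_derive_trigpoly c x) (is_derive_trigpoly_sq c x)).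
  by move=> /trigger_derive; apply; rewrite /sq_deriv; field.
apply: (circle_int_derive d); last by rewrite trigpoly_periodic.
by apply: continuousM_fun; [exact: continuous_trigpoly_sq|exact: continuous_trigpoly].
Qed.

(** The dispersive terms cancel in each pair (a_n, b_n); what remains is 1 / pi
    times the integral of u^2 u_x. *)
Lemma dotrV_bo_field c : dotrV c (bo_field c) = 0.
Proof.
rewrite dotrV_coef.
transitivity (pi^-1 * circle_int (fun x => trigpoly c x ^+ 2 * trigpoly (dtrig c) x)).
  rewrite circle_int_sq_trigpoly mulr_sumr; apply: eq_bigr => k _.
  by rewrite !acoef_of_coefs !bcoef_of_coefs; ring.
by rewrite circle_int_sq_dtrig mulr0.
Qed.

Lemma solves_dotrV u (X : E -> E) w t : solves X u ->
  is_derive t (1 : R) (fun s => dotrV (u s) w) (dotrV (X (u t)) w).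
Proof.
move=> Xu; apply: is_derive_sumf => i.
have := is_deriveZf (w ord0 i) (is_derive_coord i (Xu t)).
rewrite (_ : (fun s => w ord0 i * u s ord0 i) = (fun s => u s ord0 i * w ord0 i)); last first.
  by apply/funext => s; rewrite mulrC.
by move=> /trigger_derive; apply; rewrite mulrC.
Qed.

Lemma solves_dotrV_sq u (X : E -> E) t : solves X u ->
  is_derive t (1 : R) (fun s => dotrV (u s) (u s)) (2 * dotrV (u t) (X (u t))).
Proof.
move=> Xu; rewrite [2 * _]mulr_sumr; apply: is_derive_sumf => i.
have d := is_derive_coord i (Xu t).
have := is_deriveM_fun d d; move=> /trigger_derive; apply; ring.
Qed.

Lemma bo_dotrV_conserved u t : solves bo_field u ->
  dotrV (u t) (u t) = dotrV (u 0) (u 0).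
Proof.
move=> Xu; apply: (is_derive_0_is_cst (f := fun s => dotrV (u s) (u s))) => s.
have := solves_dotrV_sq s Xu.
by move=> /trigger_derive; apply; rewrite dotrV_bo_field mulr0.
Qed.

Lemma exact_quad_int M n (f : R -> R) : (n < M)%N -> exact_quad M n f ->
  circle_int f = quad M f.
Proof.
move=> nM [_ /(_ 0)]; rewrite add0n => /(_ nM) [].
by rewrite (_ : (fun x => f x * cosz 0 x) = f)//; apply/funext => x; rewrite /cosz mul0r cos0 mulr1.
Qed.

(** u^2 has degree 2 N and is tested against frequencies up to N; the
    rule with more than 3 N nodes is exact for such products. *)
Local Notation M := (N * 3).+1.

Lemma exact_quad_sq c : exact_quad M (N + N) (fun x => trigpoly c x ^+ 2).
Proof.
have := exact_quad_trigpoly c (exact_quad_trigpoly c (exact_quad1 M)).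
rewrite add0n (_ : (fun x => _ * _ * _) = (fun x => trigpoly c x ^+ 2))//.
by apply/funext => x /=; rewrite mul1r expr2.
Qed.

Lemma circle_int_sq_quad c d :
  circle_int (fun x => trigpoly c x ^+ 2 * trigpoly d x) =
  quad M (fun x => trigpoly c x ^+ 2 * trigpoly d x).
Proof.
apply: (exact_quad_int (n := (N + N) + N)%N); first by lia.
exact/exact_quad_trigpoly/exact_quad_sq.
Qed.

Lemma circle_int_cube c :
  circle_int (fun x => trigpoly c x ^+ 3) = quad M (fun x => trigpoly c x ^+ 3).
Proof.
have := circle_int_sq_quad c c.
by rewrite (_ : (fun x => _ * _) = (fun x => trigpoly c x ^+ 3))//; apply/funext => x; rewrite -exprSr.
Qed.

Lemma sqcos_quad c k :
  sqcos c k = quad M (fun x => trigpoly c x ^+ 2 * cosz k.+1 x).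
Proof. by have [_ /(_ k.+1)[]] := exact_quad_sq c; first by have := ltn_ord k; lia. Qed.

Lemma sqsin_quad c k :
  sqsin c k = quad M (fun x => trigpoly c x ^+ 2 * sinz k.+1 x).
Proof. by have [_ /(_ k.+1)[]] := exact_quad_sq c; first by have := ltn_ord k; lia. Qed.

(** Twice the usual Hamiltonian: normalized to be the exponent of the Gibbs
    density. *)
Definition hamiltonian c : R :=
  pi * \sum_(k < N) k.+1%:R * (acoef c k ^+ 2 + bcoef c k ^+ 2) +
  2 / 3 * circle_int (fun x => trigpoly c x ^+ 3).

(** The integral of u^3 is replaced by a finite sum over the nodes, so that it can
    be differentiated in time term by term; going back from nodes to integrals, the
    derivative is the pairing of [bo_field] with the gradient, which vanishes in
    each pair (a_n, b_n). *)
Lemma bo_hamiltonian_conserved u t : solves bo_field u ->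
  hamiltonian (u t) = hamiltonian (u 0).
Proof.
move=> Xu; apply: (is_derive_0_is_cst (f := fun s => hamiltonian (u s))) => s.
have cubeE (v : E) : circle_int (fun x => trigpoly v x ^+ 3) =
  quad M (fun x => trigpoly v x * (trigpoly v x * trigpoly v x)).
  by rewrite circle_int_cube; congr (_ * _); apply: eq_bigr => j _; ring.
rewrite /hamiltonian (_ : (fun s => _) = (fun s => pi * \sum_(k < N) k.+1%:R *
   (acoef (u s) k * acoef (u s) k + bcoef (u s) k * bcoef (u s) k) +
   2 / 3 * (2 * pi / M%:R * \sum_(j < M) (trigpoly (u s) (node M j) *
     (trigpoly (u s) (node M j) * trigpoly (u s) (node M j)))))); last first.
  by apply/funext => r; rewrite cubeE.
set b := bo_field (u s).
have da k : is_derive s (1 : R) (fun r => acoef (u r) k) (acoef b k).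
  exact: is_derive_coord.
have db k : is_derive s (1 : R) (fun r => bcoef (u r) k) (bcoef b k).
  exact: is_derive_coord.
have dt x : is_derive s (1 : R) (fun r => trigpoly (u r) x) (trigpoly b x).
  under eq_fun do rewrite trigpoly_dotrV.
  by rewrite trigpoly_dotrV; exact: solves_dotrV.
have d1 := is_deriveZf pi (is_derive_sumf (fun k =>
  is_deriveZf k.+1%:R (is_deriveD (is_deriveM_fun (da k) (da k)) (is_deriveM_fun (db k) (db k))))).
have d2 := is_deriveZf (2 / 3) (is_deriveZf (2 * pi / M%:R) (is_derive_sumf (fun j : 'I_M =>
  is_deriveM_fun (dt (node M j)) (is_deriveM_fun (dt (node M j)) (dt (node M j)))))).
have := is_deriveD d1 d2; move=> /trigger_derive; apply.
have -> : 2 / 3 * (2 * pi / M%:R * \sum_(i < M)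
   (trigpoly b (node M i) * (trigpoly (u s) (node M i) * trigpoly (u s) (node M i)) +
    trigpoly (u s) (node M i) *
    (trigpoly b (node M i) * trigpoly (u s) (node M i) +
     trigpoly (u s) (node M i) * trigpoly b (node M i)))) =
  2 * \sum_k (acoef b k * sqcos (u s) k + bcoef b k * sqsin (u s) k).
  rewrite -circle_int_sq_trigpoly circle_int_sq_quad /quad.
  rewrite (eq_bigr (fun i : 'I_M => 3 * (trigpoly (u s) (node M i) ^+ 2 * trigpoly b (node M i)))); last first.
    by move=> i _; ring.
  rewrite -mulr_sumr; set S := \sum_(j < M) _; move: (pi : R) S => p S.
  have M0 : M%:R != 0 :> R by rewrite pnatr_eq0.
  by move: (M%:R : R) M0 => m m0; field.
rewrite !mulr_sumr -big_split big1//= => k _.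
rewrite !acoef_of_coefs !bcoef_of_coefs.
by move: (pi : R) p0 => p p0'; field.
Qed.

End conservation.

(** * The truncated Benjamin-Ono field as a sum of shears *)
Section shears.
Context {R : realType} {N : nat}.
Local Notation E := (E_ R N).
Local Notation M := (N * 3).+1.

(** A shear per node [x_j], with profile u(x_j)^2 and direction the derivative of
    the Dirichlet kernel centered at [x_j] (up to a factor), and two shears per
    frequency, which make up the rotation in the plane (a_n, b_n) generated by the
    dispersion. *)
Let I : finType := ('I_M + ('I_N + 'I_N))%type.

Definition bo_shear_g (i : I) (y : R) : R := if i is inl _ then y ^+ 2 else y.

Definition bo_shear_w (i : I) : E :=
  match i with
  | inl j => of_coefs (fun k => cosz k.+1 (node M j)) (fun k => sinz k.+1 (node M j))
  | inr (inl l) => of_coefs (fun=> 0) (fun k => (k == l)%:R)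
  | inr (inr l) => of_coefs (fun k => (k == l)%:R) (fun=> 0)
  end.

Definition bo_shear_v (i : I) : E :=
  match i with
  | inl j => of_coefs (fun k => - (2 * k.+1%:R / M%:R * sinz k.+1 (node M j)))
                 (fun k => 2 * k.+1%:R / M%:R * cosz k.+1 (node M j))
  | inr (inl l) => of_coefs (fun k => - k.+1%:R ^+ 2 * (k == l)%:R) (fun=> 0)
  | inr (inr l) => of_coefs (fun=> 0) (fun k => k.+1%:R ^+ 2 * (k == l)%:R)
  end.

Lemma bo_shear_orth i : dotrV (bo_shear_v i) (bo_shear_w i) = 0.
Proof.
by rewrite dotrV_coef big1// => k _; case: i => [j|[l|l]];
  rewrite !acoef_of_coefs !bcoef_of_coefs; ring.
Qed.

Lemma bo_shear_lipschitz i (B : R) : exists2 L, 0 <= L &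
  forall x y, `|x| <= B -> `|y| <= B ->
  `|bo_shear_g i x - bo_shear_g i y| <= L * `|x - y|.
Proof.
case: i => [j|i]; last by exists 1 => // x y _ _; rewrite mul1r.
exists (`|B| + `|B|); first by rewrite addr_ge0.
move=> x y xB yB; rewrite /= subr_sqr normrM mulrC ler_wpM2r//.
by apply: le_trans (ler_normD _ _) _; rewrite lerD// (le_trans _ (ler_norm B)).
Qed.

Lemma acoef_sum (J : finType) (F : J -> E) k :
  acoef (\sum_i F i) k = \sum_i acoef (F i) k.
Proof. by rewrite /acoef summxE. Qed.

Lemma bcoef_sum (J : finType) (F : J -> E) k :
  bcoef (\sum_i F i) k = \sum_i bcoef (F i) k.
Proof. by rewrite /bcoef summxE. Qed.

Lemma acoefZ a (c : E) k : acoef (a *: c) k = a * acoef c k.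
Proof. by rewrite /acoef mxE. Qed.

Lemma bcoefZ a (c : E) k : bcoef (a *: c) k = a * bcoef c k.
Proof. by rewrite /bcoef mxE. Qed.

Lemma bo_field_shears c : bo_field c = shear_field bo_shear_g bo_shear_w bo_shear_v c.
Proof.
have p0 : pi != 0 :> R by rewrite gt_eqF// pi_gt0.
have M0 : M%:R != 0 :> R by rewrite pnatr_eq0.
have wa l : dotrV c (bo_shear_w (inr (inr l))) = acoef c l.
  rewrite dotrV_coef (bigD1 l)//= big1 => [|k kl].
    by rewrite acoef_of_coefs bcoef_of_coefs eqxx mulr1 mulr0 !addr0.
  by rewrite acoef_of_coefs bcoef_of_coefs (negbTE kl) !mulr0 addr0.
have wb l : dotrV c (bo_shear_w (inr (inl l))) = bcoef c l.
  rewrite dotrV_coef (bigD1 l)//= big1 => [|k kl].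
    by rewrite acoef_of_coefs bcoef_of_coefs eqxx mulr1 mulr0 add0r addr0.
  by rewrite acoef_of_coefs bcoef_of_coefs (negbTE kl) !mulr0 addr0.
rewrite /shear_field; apply: coefP => k.
  rewrite acoef_sum big_sumType /= big_sumType /= acoef_of_coefs.
  rewrite [X in _ = _ + (_ + X)]big1 ?addr0; last first.
    by move=> l _; rewrite acoefZ acoef_of_coefs mulr0.
  rewrite [X in _ = _ + X](bigD1 k)//= [X in _ = _ + (_ + X)]big1 ?addr0; last first.
    by move=> l lk; rewrite acoefZ acoef_of_coefs eq_sym (negbTE lk) !mulr0.
  rewrite acoefZ acoef_of_coefs eqxx mulr1 wb sqsin_quad /quad addrC (mulrC (bcoef c k)).
  congr (_ + _); rewrite mulrA mulr_sumr -sumrN.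
  apply: eq_bigr => j _; rewrite acoefZ acoef_of_coefs -trigpoly_dotrV.
  set U := trigpoly _ _; set cs := sinz _ (node _ _).
  by move: (pi : R) p0 (M%:R : R) M0 U cs => p p0 m m0 U cs; field; rewrite p0 m0.
rewrite bcoef_sum big_sumType /= big_sumType /= bcoef_of_coefs.
rewrite [X in _ = _ + (X + _)]big1 ?add0r; last first.
  by move=> l _; rewrite bcoefZ bcoef_of_coefs mulr0.
rewrite [X in _ = _ + X](bigD1 k)//= [X in _ = _ + (_ + X)]big1 ?addr0; last first.
  by move=> l lk; rewrite bcoefZ bcoef_of_coefs eq_sym (negbTE lk) !mulr0.
rewrite bcoefZ bcoef_of_coefs eqxx mulr1 wa sqcos_quad /quad addrC (mulrC (acoef c k)).
congr (_ + _); rewrite mulrA mulr_sumr.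
apply: eq_bigr => j _; rewrite bcoefZ bcoef_of_coefs -trigpoly_dotrV.
set U := trigpoly _ _; set cs := cosz _ (node _ _).
  by move: (pi : R) p0 (M%:R : R) M0 U cs => p p0 m m0 U cs; field; rewrite p0 m0.
Qed.

End shears.

(** * Invariance of the Gibbs measure *)
Section gibbs_density.
Context {R : realType} {N : nat} (chi : R -> R).
Hypothesis chi_cont : continuous chi.
Hypothesis chi_ge0 : forall x, 0 <= chi x.
Local Notation E := (E_ R N).

(** The density of the Gibbs measure with respect to Lebesgue measure: the Gaussian
    factor and the interaction combine into the Hamiltonian. *)
Definition gibbs_weight (c : E) : R :=
  chi (pi * dotrV c c - alpha N) * (N`!%:R * expR (- hamiltonian c)).

Lemma gibbs_weight_ge0 c : 0 <= gibbs_weight c.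
Proof. by rewrite mulr_ge0// mulr_ge0// expR_ge0. Qed.

Lemma measurable_trigpoly_at x :
  measurable_fun setT (fun c : borel R (N + N) => trigpoly (c : E) x).
Proof.
apply: measurable_sum => k; apply: measurable_funD; apply: measurable_funM => //;
  exact: measurable_coord.
Qed.

Lemma measurable_cubic :
  measurable_fun setT (fun c : borel R (N + N) => circle_int (fun x => trigpoly (c : E) x ^+ 3)).
Proof.
under eq_fun do rewrite circle_int_cube.
rewrite /quad; apply: measurable_funM => //; apply: measurable_sum => j.
by apply: measurable_funX; exact: measurable_trigpoly_at.
Qed.

Lemma measurable_chi_dotrV :
  measurable_fun setT (fun c : borel R (N + N) => chi (pi * dotrV (c : E) c - alpha N)).
Proof.
apply: (measurableT_comp (continuous_measurable_fun chi_cont)).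
apply: measurable_funB => //; apply: measurable_funM => //.
by apply: measurable_sum => i; apply: measurable_funM; exact: measurable_coord.
Qed.

Lemma measurable_interaction :
  measurable_fun setT (fun c : borel R (N + N) =>
    expR (- (2 / 3) * circle_int (fun x => trigpoly (c : E) x ^+ 3))).
Proof.
by apply: measurableT_comp => //; apply: measurable_funM => //; exact: measurable_cubic.
Qed.

Lemma gibbs_weightE c :
  chi (L2norm (trigpoly c) ^+ 2 - alpha N) *
    expR (- (2 / 3) * circle_int (fun x => trigpoly c x ^+ 3)) * gauss_density c =
  gibbs_weight c.
Proof.
rewrite /gibbs_weight L2norm_trigpoly /gauss_density /hamiltonian -mulrA.
by congr (_ * _); rewrite mulrCA -expRD; congr (_ * expR _); ring.
Qed.

Lemma measurable_gibbs_weight :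
  measurable_fun setT (gibbs_weight : borel R (N + N) -> R).
Proof.
have -> : gibbs_weight = (fun c => chi (pi * dotrV c c - alpha N) *
    expR (- (2 / 3) * circle_int (fun x => trigpoly c x ^+ 3)) * gauss_density c).
  by apply/funext => c; rewrite -gibbs_weightE L2norm_trigpoly.
apply: measurable_funM; last exact: measurable_gauss_density.
apply: measurable_funM; [exact: measurable_chi_dotrV|exact: measurable_interaction].
Qed.

Lemma gibbsE (A : set (borel R (N + N))) : measurable A ->
  gibbs chi A = (\int[lebesgue_rV R (N + N)]_(c in A) (gibbs_weight c)%:E)%E.
Proof.
move=> mA; rewrite /gibbs.
rewrite (@ge0_integral_density _ _ _ (lebesgue_rV R (N + N)) (@theta R N) (@gauss_density R N))//.
- by apply: eq_integral => c _; rewrite -EFinM gibbs_weightE.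
- exact: measurable_gauss_density.
- exact: gauss_density_ge0.
- apply/measurable_EFinP; apply: measurable_funTS.
  under eq_fun do rewrite L2norm_trigpoly.
  apply: measurable_funM; [exact: measurable_chi_dotrV|exact: measurable_interaction].
- by move=> c; rewrite lee_fin mulr_ge0// expR_ge0.
Qed.

End gibbs_density.

Unset Implicit Arguments.
Set Strict Implicit.

Theorem mainTheorem2 (R : realType) (r : R) (r0 : 0 < r) (chi : R -> R)
    (chi_cont : continuous chi)
    (chi01 : forall x : R, 0 <= chi x <= 1)
    (chi_supp : compact (closure [set x : R | chi x != 0]))
    (chi1 : forall x : R, `|x| <= r -> chi x = 1)
    (N : nat) (N1 : (1 <= N)%N)
    (Phi : R -> E_ R N -> E_ R N) (Phi_flow : is_bo_flow Phi)
    (A : set (borel R (N + N))) (mA : measurable A) (t : R) :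
  gibbs chi (Phi t @` A) = gibbs chi A.
Proof.
have chi0 x : 0 <= chi x by have /andP[] := chi01 x.
have Phi0 c : Phi 0 c = c by have [] := Phi_flow c.
have PhiBO c : solves bo_field (Phi^~ c).
  by apply: is_bo_solution_solves; have [] := Phi_flow c.
have PhiX c : solves (shear_field bo_shear_g bo_shear_w bo_shear_v) (Phi^~ c).
  by move=> s; rewrite -bo_field_shears; exact: PhiBO.
have Phi_sq s c : dotrV (Phi s c) (Phi s c) = dotrV c c.
  by rewrite (bo_dotrV_conserved s (PhiBO c)) Phi0.
have Phi_weight s c : gibbs_weight chi (Phi s c) = gibbs_weight chi c.
  rewrite /gibbs_weight Phi_sq.
  by rewrite (bo_hamiltonian_conserved s (PhiBO c)) Phi0.
have mPhi s : measurable_fun setT (Phi s : borel R (N + N) -> borel R (N + N)).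
  exact: (measurable_flow (@bo_shear_orth R N) (@bo_shear_lipschitz R N) Phi0 PhiX Phi_sq).
have vol s := shear_flow_volume (@bo_shear_orth R N) (@bo_shear_lipschitz R N) Phi0 PhiX Phi_sq s.
have -> : Phi t @` A = Phi (- t) @^-1` A.
  exact: (flow_preimage (@bo_shear_orth R N) (@bo_shear_lipschitz R N) Phi0 PhiX Phi_sq).
have mPA : measurable (Phi (- t) @^-1` A : set (borel R (N + N))).
  by rewrite -[X in measurable X]setTI; exact: mPhi.
rewrite !gibbsE//.
transitivity (\int[lebesgue_rV R (N + N)]_(c in Phi (- t)%R @^-1` A)
    ((fun c => (gibbs_weight chi c)%:E) \o (Phi (- t)%R : borel R (N + N) -> borel R (N + N))) c)%E.
  by apply: eq_integral => c _; rewrite /= Phi_weight.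
rewrite -(ge0_integral_pushforward (mPhi (- t)) (lebesgue_rV R (N + N)) mA).
- by apply: eq_measure_integral => B mB _; exact: vol.
- by apply/measurable_EFinP; apply: measurable_funTS; exact: measurable_gibbs_weight.
- by move=> c _; rewrite lee_fin gibbs_weight_ge0.
Qed.
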